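(* Let $k$ be a perfect field. (i) A $k$-algebra $\Lambda$ is finite dimensional with non-zero unity element if and only if $\Lambda$ is isomorphic to a generalized path algebra with weak relations $k(D,\Omega,\rho)$ where $D$ is a finite directed graph and $\dim_k\Omega<\infty$. (ii) Let $\Lambda$ be a finite dimensional $k$-algebra with non-zero unity element and Jacobson radical $r$, and write $\Lambda/r=B_1\oplus B_2\oplus\cdots\oplus B_n$ as algebras, where each $B_i$ is a simple subalgebra of $\Lambda/r$. Then $\Lambda$ is isomorphic to a generalized path algebra with weak relations $k(D,\Omega,\rho)$ of a finite directed graph $D$ with vertex set $I=\{1,2,\dots,n\}$ and $\Omega_{ii}=B_i$ for all $i\in I$. (iii) Let $\Lambda$ be a finite dimensional $k$-algebra with non-zero unity element. Then for any integer $m$ with $1\le m\le n_{WA}(\Lambda)$, $\Lambda$ is isomorphic to a generalized path algebra with weak relations $k(D,\Omega,\rho)$ with $|D_0|=m$.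
   Context: Algebras are associative over the field $k$ and need not have a unity element; $r(\Lambda)$ denotes the Jacobson radical. *Wedderburn–Artin number.* If $\Lambda/r(\Lambda)$ is left (or right) artinian with non-zero unity element, then $\Lambda/r(\Lambda)=B_1\oplus\cdots\oplus B_n$ as algebras with each $B_i$ simple, and $n_{WA}(\Lambda):=n$. *Generalized path algebras.* Let $D$ be a directed graph (possibly infinite, loops and multiple arrows allowed) with non-empty vertex set $I=D_0$ and arrow set $D_1$; $D$ is finite if $D_0$ and $D_1$ are finite. Let $\Omega=\bigoplus_{i\in I}\Omega_{ii}$ be a direct sum of $k$-algebras ($\Omega_{ii}\Omega_{jj}=0$ for $i\neq j$), each $\Omega_{ii}$ having a non-zero unity element $e_{ii}$ and $r(\Omega_{ii})=0$. An $\Omega$-path from $i_0$ to $i_n$ of length $n\ge 1$ is a sequence $a_{i_0}x_{i_0i_1}a_{i_1}x_{i_1i_2}\cdots x_{i_{n-1}i_n}a_{i_n}$ with $x_{i_{p-1}i_p}$ an arrow from $i_{p-1}$ to $i_p$ and $0\ne a_{i_p}\in\Omega_{i_pi_p}$. For $i,j\in I$ let $A_{ij}$ be the $k$-space spanned by the $\Omega$-paths of positive length from $i$ to $j$ modulo the relations making them $k$-multilinear in the entries $a_{i_p}$ (a path with a zero entry being $0$), together with $\Omega_{ii}$ as an additional direct summand when $i=j$. The generalized path algebra is $k(D,\Omega)=\bigoplus_{i,j\in I}A_{ij}$, with multiplication by concatenation: the product of a path ending with $a_{i_n}$ and a path starting with $b_{j_0}$ is the path obtained by joining them with middle entry $a_{i_n}b_{j_0}$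 if $i_n=j_0$, and is $0$ if $i_n\ne j_0$; elements of $\Omega_{ii}$ multiply into the first or last entry, and $\Omega$ is a subalgebra. An arrow $x$ from $i$ to $j$ is identified with $e_{ii}xe_{jj}$. Let $J$ be the ideal of $k(D,\Omega)$ generated by all arrows. For a non-empty subset $\rho\subseteq k(D,\Omega)$ let $(\rho)$ be the ideal it generates and $k(D,\Omega,\rho)=k(D,\Omega)/(\rho)$. It is a generalized path algebra *with weak relations* if $J^t\subseteq(\rho)\subseteq J$ for some positive integer $t$. *)

(* Defs.v *)
From HB Require Import structures.
From mathcomp Require Import all_boot all_algebra separable.
From mathcomp Require Import boolp classical_sets cardinality.
From mathcomp Require Import finmap monalg.

Set Implicit Arguments.
Unset Strict Implicit.
Unset Printing Implicit Defensive.

Import GRing.Theory.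
Local Open Scope ring_scope.
Local Open Scope classical_set_scope.

Reserved Notation "x ** y" (at level 40, left associativity).

Definition perfect_field (k : fieldType) : Prop :=
  forall p : {poly k}, irreducible_poly p -> separable_poly p.

(* Associative algebras, not necessarily with a unity element. *)
HB.mixin Record Lmodule_isNuAlgebra (k : fieldType) A of GRing.Lmodule k A := {
  numul : A -> A -> A;
  numulA : associative numul;
  numulDl : left_distributive numul +%R;
  numulDr : right_distributive numul +%R;
  numulZl : forall (c : k) x y, numul (c *: x) y = c *: numul x y;
  numulZr : forall (c : k) x y, numul x (c *: y) = c *: numul x y
}.

#[short(type="nuAlgType")]
HB.structure Definition NuAlgebra (k : fieldType) :=
  {A of GRing.Lmodule k A & Lmodule_isNuAlgebra k A}.

Notation "x ** y" := (numul x y) : ring_scope.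

Definition findim (k : fieldType) (V : lmodType k) : Prop :=
  exists n, inhabited (Vector.axiom n V).

Section Spans.
Variables (k : fieldType) (V : lmodType k).

Definition is_subspace (S : set V) : Prop :=
  S 0 /\ forall (c : k) u v, S u -> S v -> S (c *: u + v).

Definition span (X : set V) : set V :=
  fun v => forall S, is_subspace S -> X `<=` S -> S v.

Lemma subspaceD S u v : is_subspace S -> S u -> S v -> S (u + v).
Proof. by move=> [_ h] Su Sv; rewrite -[u]scale1r; apply: h. Qed.

Lemma subspaceZ S c u : is_subspace S -> S u -> S (c *: u).
Proof. by move=> [S0 h] Su; rewrite -[_ *: _]addr0; apply: h. Qed.

Lemma subspaceB S u v : is_subspace S -> S u -> S v -> S (u - v).
Proof.
by move=> hS Su Sv; apply: subspaceD => //; rewrite -scaleN1r; apply: subspaceZ.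
Qed.

Lemma subspace_sum S (I : Type) (r : seq I) (F : I -> V) :
  is_subspace S -> (forall i, S (F i)) -> S (\sum_(i <- r) F i).
Proof.
move=> hS hF; elim/big_ind : _ => //; first exact: hS.1.
by move=> x y; apply: subspaceD.
Qed.

Lemma span_subspace X : is_subspace (span X).
Proof.
split=> [S [] //|c u v hu hv S hS XS].
by apply: hS.2; [exact: hu|exact: hv].
Qed.

Lemma sub_span X : X `<=` span X.
Proof. by move=> x Xx S _; apply. Qed.

End Spans.

Section Algebras.
Variable k : fieldType.
Implicit Type A : nuAlgType k.

Lemma numul0r A (x : A) : 0 ** x = 0.
Proof. by have := numulZl (0 : k) (0 : A) x; rewrite !scale0r. Qed.

Lemma numulr0 A (x : A) : x ** 0 = 0.
Proof. by have := numulZr (0 : k) x (0 : A); rewrite !scale0r. Qed.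

Lemma numulBl A (x y z : A) : (x - y) ** z = x ** z - y ** z.
Proof. by rewrite -[- y]scaleN1r numulDl numulZl scaleN1r. Qed.

Lemma numulBr A (x y z : A) : x ** (y - z) = x ** y - x ** z.
Proof. by rewrite -[- z]scaleN1r numulDr numulZr scaleN1r. Qed.

Definition is_unity A (e : A) : Prop := forall x, e ** x = x /\ x ** e = x.

Definition has_nonzero_unity A : Prop := exists2 e : A, e != 0 & is_unity e.

Definition alg_iso A (B : nuAlgType k) : Prop :=
  exists f : {linear A -> B}, {morph f : x y / x ** y} /\ bijective f.

Definition is_left_ideal A (S : set A) : Prop :=
  is_subspace S /\ forall a x, S x -> S (a ** x).

Definition is_ideal A (S : set A) : Prop :=
  is_subspace S /\ forall a x, S x -> S (a ** x) /\ S (x ** a).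

Record ideal A := Ideal {ideal_set :> set A; idealP : is_ideal ideal_set}.

Definition ideal_gen_set A (X : set A) : set A :=
  fun x => forall S, is_ideal S -> X `<=` S -> S x.

Lemma ideal_gen_is_ideal A (X : set A) : is_ideal (ideal_gen_set X).
Proof.
split; first split=> [S [[]] //|c u v hu hv S hS XS].
  by apply: hS.1.2; [exact: hu|exact: hv].
by move=> a x hx; split=> S hS XS; have [] := hS.2 a x (hx S hS XS).
Qed.

Definition ideal_gen A (X : set A) : ideal A := Ideal (ideal_gen_is_ideal X).

(* [ideal_pow I t] is the ideal power I^t for t >= 1 (it is I for t = 0). *)
Definition ideal_pow A (I : set A) (t : nat) : set A :=
  iter t.-1 (fun X => span [set z | exists x y, X x /\ I y /\ z = x ** y]) I.

Definition simple_alg A : Prop :=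
  (exists x y : A, x ** y != 0) /\
  forall S : set A, is_ideal S -> S = [set 0] \/ S = setT.

(* A left ideal M is modular if some e is a right identity modulo M; in an
   algebra with unity every left ideal is modular. *)
Definition modular_maximal_left_ideal A (M : set A) : Prop :=
  [/\ is_left_ideal M, exists e, forall x, M (x - x ** e), M <> setT &
      forall N : set A, is_left_ideal N -> M `<=` N -> N = M \/ N = setT].

(* The intersection of the modular maximal left ideals, i.e. the Jacobson
   radical of a ring that may lack a unity element. *)
Definition jacobson_set A : set A :=
  fun x => forall M, modular_maximal_left_ideal M -> M x.

Lemma jacobson_is_ideal A : is_ideal (@jacobson_set A).
Proof.
have lid : is_left_ideal (@jacobson_set A).
  split; first split=> [M [[[]]] //|c u v hu hv M hM].
    by have [[hs _] _ _ _] := hM; apply: hs.2; [exact: hu M hM|exact: hv M hM].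
  by move=> a x hx M hM; have [[_ h] _ _ _] := hM; apply: h; exact: hx M hM.
split; first exact: lid.1.
move=> a x hx; split=> [|M [[sM lM] [e he] MT maxM]]; first exact: lid.2.
pose N : set A := fun y => M (y ** a).
have lN : is_left_ideal N.
  split; first split; rewrite /N; first by rewrite numul0r; exact: sM.1.
    by move=> c u v Mu Mv; rewrite numulDl numulZl; apply: sM.2.
  by move=> b y My; rewrite /N -numulA; apply: lM.
case: (pselect (N = setT)) => [NT|NT]; first by rewrite -[M _]/(N x) NT.
(* any left ideal properly above N maps onto A modulo M *)
have top (L : set A) : is_left_ideal L -> N `<=` L -> L <> N ->
    forall z, exists2 y, L y & M (z - y ** a).
  move=> lL NL LN.
  pose P : set A := fun z => exists2 y, L y & M (z - y ** a).
  have lP : is_left_ideal P.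
    split; first split.
    - by exists 0; [exact: lL.1.1 | rewrite numul0r subrr; exact: sM.1].
    - move=> c u v [y Ly My] [z Lz Mz]; exists (c *: y + z).
        exact: lL.1.2.
      rewrite numulDl numulZl opprD addrACA -scalerBr; exact: sM.2.
    - move=> b u [y Ly My]; exists (b ** y); first exact: lL.2.
      by rewrite -numulA -numulBr; apply: lM.
  have MP : M `<=` P.
    by move=> z Mz; exists 0; [exact: lL.1.1 | rewrite numul0r subr0].
  have [PM|PT z] := maxM P lP MP; last by have : P z by rewrite PT.
  case: LN; apply/seteqP; split=> // y Ly; rewrite /N -PM.
  by exists y => //; rewrite subrr; exact: sM.1.
have sT : is_left_ideal [set: A] by [].
have onto := top setT sT (fun _ _ => I) (fun h => NT (esym h)).
suff : modular_maximal_left_ideal N by exact: hx.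
split=> //.
- have [e' _ He'] := onto a; exists e' => y.
  by rewrite /N numulBl -numulA -numulBr; apply: lM.
- move=> L lL NL; case: (pselect (L = N)) => [|LN]; [by left | right].
  apply/seteqP; split=> // y _.
  have [z Lz Mz] := top L lL NL LN (y ** a).
  rewrite -[y](subrK z); apply: subspaceD => //; first exact: lL.1.
  by apply: NL; rewrite /N numulBl.
Qed.

Definition jacobson A : ideal A := Ideal (@jacobson_is_ideal A).

End Algebras.

Section Quotient.
Variables (k : fieldType) (A : nuAlgType k) (I : ideal A).

Definition ideal_mem : {pred A} := fun x => `[< ideal_set I x >].

Lemma ideal_zmod_closed : zmod_closed ideal_mem.
Proof.
have [sI _] := idealP I.
split=> [|x y /asboolP Ix /asboolP Iy]; apply/asboolP; first exact: sI.1.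
exact: subspaceB.
Qed.

HB.instance Definition _ := GRing.isZmodClosed.Build A ideal_mem
  ideal_zmod_closed.

Definition quotalg : Type := Quotient.quot ideal_mem.
HB.instance Definition _ := GRing.Zmodule.on quotalg.

Definition quot_proj (x : A) : quotalg := \pi_(Quotient.quot ideal_mem)%qT x.

Lemma quot_projP x y : quot_proj x = quot_proj y <-> ideal_set I (x - y).
Proof.
split=> [/eqP|h]; first by rewrite -Quotient.idealrBE => /asboolP.
by apply/eqP; rewrite -Quotient.idealrBE; apply/asboolP.
Qed.

Lemma quot_projD x y : quot_proj (x + y) = quot_proj x + quot_proj y.
Proof. exact: raddfD. Qed.

Lemma quot_proj_repr (u : quotalg) : quot_proj (repr u) = u.
Proof. exact: reprK. Qed.

Definition quot_scale (c : k) (u : quotalg) : quotalg := quot_proj (c *: repr u).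
Definition quot_mul (u v : quotalg) : quotalg := quot_proj (repr u ** repr v).

Lemma repr_quot_proj x : ideal_set I (repr (quot_proj x) - x).
Proof. by apply/quot_projP; rewrite quot_proj_repr. Qed.

Lemma quot_scaleE c x : quot_scale c (quot_proj x) = quot_proj (c *: x).
Proof.
apply/quot_projP; rewrite -scalerBr; apply: subspaceZ (repr_quot_proj x).
exact: (idealP I).1.
Qed.

Lemma quot_mulE x y : quot_mul (quot_proj x) (quot_proj y) = quot_proj (x ** y).
Proof.
apply/quot_projP; set x' := repr _; set y' := repr _.
have -> : x' ** y' - x ** y = (x' - x) ** y' + x ** (y' - y).
  by rewrite numulBl numulBr addrA subrK.
have [sI mI] := idealP I; apply: subspaceD => //.
  by have [] := mI y' _ (repr_quot_proj x).
by have [] := mI x _ (repr_quot_proj y).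
Qed.

Lemma quot_ind (P : quotalg -> Prop) : (forall x, P (quot_proj x)) -> forall u, P u.
Proof. by move=> h u; rewrite -[u]quot_proj_repr. Qed.

Lemma quot_scaleA a b (u : quotalg) :
  quot_scale a (quot_scale b u) = quot_scale (a * b) u.
Proof. by elim/quot_ind: u => x; rewrite !quot_scaleE scalerA. Qed.

Lemma quot_scale1 : left_id 1 quot_scale.
Proof. by elim/quot_ind=> x; rewrite quot_scaleE scale1r. Qed.

Lemma quot_scaleDr : right_distributive quot_scale +%R.
Proof.
move=> c; elim/quot_ind=> x; elim/quot_ind=> y.
by rewrite -quot_projD !quot_scaleE scalerDr quot_projD.
Qed.

Lemma quot_scaleDl u : {morph quot_scale^~ u : a b / a + b}.
Proof.
by move=> a b; elim/quot_ind: u => x; rewrite !quot_scaleE scalerDl quot_projD.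
Qed.

HB.instance Definition _ := GRing.Zmodule_isLmodule.Build k quotalg
  quot_scaleA quot_scale1 quot_scaleDr quot_scaleDl.

Lemma quot_projZ c x : quot_proj (c *: x) = c *: quot_proj x.
Proof. by rewrite -quot_scaleE. Qed.

Lemma quot_mulA : associative quot_mul.
Proof.
elim/quot_ind=> x; elim/quot_ind=> y; elim/quot_ind=> z.
by rewrite !quot_mulE numulA.
Qed.

Lemma quot_mulDl : left_distributive quot_mul +%R.
Proof.
elim/quot_ind=> x; elim/quot_ind=> y; elim/quot_ind=> z.
by rewrite -quot_projD !quot_mulE numulDl quot_projD.
Qed.

Lemma quot_mulDr : right_distributive quot_mul +%R.
Proof.
elim/quot_ind=> x; elim/quot_ind=> y; elim/quot_ind=> z.
by rewrite -quot_projD !quot_mulE numulDr quot_projD.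
Qed.

Lemma quot_mulZl (c : k) u v : quot_mul (c *: u) v = c *: quot_mul u v.
Proof.
elim/quot_ind: u => x; elim/quot_ind: v => y.
by rewrite -quot_projZ !quot_mulE numulZl quot_projZ.
Qed.

Lemma quot_mulZr (c : k) u v : quot_mul u (c *: v) = c *: quot_mul u v.
Proof.
elim/quot_ind: u => x; elim/quot_ind: v => y.
by rewrite -quot_projZ !quot_mulE numulZr quot_projZ.
Qed.

HB.instance Definition _ := Lmodule_isNuAlgebra.Build k quotalg
  quot_mulA quot_mulDl quot_mulDr quot_mulZl quot_mulZr.

End Quotient.

Record subalgebra (k : fieldType) (A : nuAlgType k) := Subalgebra {
  subalg_set : set A;
  subalg_subspace : is_subspace subalg_set;
  subalg_mul : forall x y, subalg_set x -> subalg_set y -> subalg_set (x ** y)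
}.

Section SubalgebraType.
Variables (k : fieldType) (A : nuAlgType k) (B : subalgebra A).

Definition subalg_mem : {pred A} := fun x => `[< subalg_set B x >].

Lemma subalg_submod_closed : submod_closed subalg_mem.
Proof.
have sB := subalg_subspace B.
split=> [|c u v /asboolP Bu /asboolP Bv]; apply/asboolP; first exact: sB.1.
exact: sB.2.
Qed.

HB.instance Definition _ := GRing.isSubmodClosed.Build k A subalg_mem
  subalg_submod_closed.

Record subalg_type := SubalgElt {subalg_val :> A; subalg_valP : subalg_val \in subalg_mem}.

HB.instance Definition _ := [isSub for subalg_val].
HB.instance Definition _ := [Choice of subalg_type by <:].
HB.instance Definition _ := [SubChoice_isSubLmodule of subalg_type by <:].

Lemma subalg_numul_subproof (u v : subalg_type) :
  subalg_val u ** subalg_val v \in subalg_mem.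
Proof.
by apply/asboolP/subalg_mul; apply/asboolP/subalg_valP.
Qed.

Definition subalg_numul (u v : subalg_type) := SubalgElt (subalg_numul_subproof u v).

Lemma subalg_numulA : associative subalg_numul.
Proof. by move=> x y z; apply: val_inj; exact: numulA. Qed.
Lemma subalg_numulDl : left_distributive subalg_numul +%R.
Proof. by move=> x y z; apply: val_inj; exact: numulDl. Qed.
Lemma subalg_numulDr : right_distributive subalg_numul +%R.
Proof. by move=> x y z; apply: val_inj; exact: numulDr. Qed.
Lemma subalg_numulZl (c : k) x y : subalg_numul (c *: x) y = c *: subalg_numul x y.
Proof. by apply: val_inj; exact: numulZl. Qed.
Lemma subalg_numulZr (c : k) x y : subalg_numul x (c *: y) = c *: subalg_numul x y.
Proof. by apply: val_inj; exact: numulZr. Qed.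

HB.instance Definition _ := Lmodule_isNuAlgebra.Build k subalg_type
  subalg_numulA subalg_numulDl subalg_numulDr subalg_numulZl subalg_numulZr.

End SubalgebraType.

Coercion subalg_type : subalgebra >-> Sortclass.

Section WedderburnArtin.
Variables (k : fieldType).
Implicit Type A : nuAlgType k.

(* A is the internal direct sum, as an algebra, of the subalgebras B i. *)
Definition alg_direct_sum A n (B : 'I_n -> subalgebra A) : Prop :=
  [/\ forall x : A, exists b : forall i, B i, x = \sum_i subalg_val (b i),
      forall b : (forall i, B i), \sum_i subalg_val (b i) = 0 -> forall i, b i = 0
    & forall i j (x : B i) (y : B j),
        i <> j -> subalg_val x ** subalg_val y = 0].

Definition simple_decomposition A n (B : 'I_n -> subalgebra A) : Prop :=
  alg_direct_sum B /\ forall i, simple_alg (B i).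

(* [n_WA] is only meant for A such that A / r(A) is one-sided artinian with a
   non-zero unity: then A / r(A) is a direct sum of simple algebras and the
   number of summands is unique. The value is 0 if there is no such sum. *)
Definition n_WA A : nat :=
  xget 0%N [set n | exists B : 'I_n -> subalgebra (quotalg (jacobson A)),
                      simple_decomposition B].

End WedderburnArtin.

(* The underlying space of the direct sum of a family of algebras. *)
Section DirectSum.
Variables (k : fieldType) (I : Type) (Omega : I -> nuAlgType k).

Record dsum := Dsum {
  dsum_fun :> forall i, Omega i;
  dsum_finite : finite_set [set i | dsum_fun i != 0]
}.

HB.instance Definition _ := gen_eqMixin dsum.
HB.instance Definition _ := gen_choiceMixin dsum.

Lemma dsumP (f g : dsum) : (forall i, f i = g i) -> f = g.
Proof.
case: f g => [f hf] [g hg] /= fgE.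
have fg : f = g by apply: functional_extensionality_dep.
by subst g; congr Dsum; exact: Prop_irrelevance.
Qed.

Lemma dsum0_subproof : finite_set [set i : I | (0 : Omega i) != 0].
Proof. by apply: (sub_finite_set _ (finite_set0 I)) => i /=; rewrite eqxx. Qed.
Definition dsum0 := Dsum dsum0_subproof.

Lemma dsumD_subproof (f g : dsum) : finite_set [set i | f i + g i != 0].
Proof.
have fg : finite_set ([set i | f i != 0] `|` [set i | g i != 0]).
  by rewrite finite_setU; split; exact: dsum_finite.
apply: (sub_finite_set _ fg) => i /=.
have [->|] := eqVneq (f i) 0; last by left.
by rewrite add0r; right.
Qed.
Definition dsumD (f g : dsum) := Dsum (dsumD_subproof f g).

Lemma dsumZ_subproof (c : k) (f : dsum) : finite_set [set i | c *: f i != 0].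
Proof.
apply: (sub_finite_set _ (dsum_finite f)) => i /=.
by apply: contra_neq => ->; rewrite scaler0.
Qed.
Definition dsumZ (c : k) (f : dsum) := Dsum (dsumZ_subproof c f).

Lemma dsumDA : associative dsumD.
Proof. by move=> f g h; apply: dsumP => i; exact: addrA. Qed.
Lemma dsumDC : commutative dsumD.
Proof. by move=> f g; apply: dsumP => i; exact: addrC. Qed.
Lemma dsum0D : left_id dsum0 dsumD.
Proof. by move=> f; apply: dsumP => i; exact: add0r. Qed.
Lemma dsumND : left_inverse dsum0 (dsumZ (-1)) dsumD.
Proof. by move=> f; apply: dsumP => i /=; rewrite scaleN1r addNr. Qed.
HB.instance Definition _ := GRing.isZmodule.Build dsum dsumDA dsumDC dsum0D dsumND.

Lemma dsumZA a b f : dsumZ a (dsumZ b f) = dsumZ (a * b) f.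
Proof. by apply: dsumP => i; exact: scalerA. Qed.
Lemma dsum1Z : left_id 1 dsumZ.
Proof. by move=> f; apply: dsumP => i; exact: scale1r. Qed.
Lemma dsumZDr : right_distributive dsumZ +%R.
Proof. by move=> c f g; apply: dsumP => i; exact: scalerDr. Qed.
Lemma dsumZDl f : {morph dsumZ^~ f : a b / a + b}.
Proof. by move=> a b; apply: dsumP => i; exact: scalerDl. Qed.
HB.instance Definition _ := GRing.Zmodule_isLmodule.Build k dsum
  dsumZA dsum1Z dsumZDr dsumZDl.

End DirectSum.

Record digraph := Digraph {
  vertex : Type;
  arrow : Type;
  source : arrow -> vertex;
  target : arrow -> vertex
}.

Definition finite_digraph (D : digraph) : Prop :=
  finite_set [set: vertex D] /\ finite_set [set: arrow D].

(* The free vector space on a type and the bilinear extension of a product on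
   its basis. *)
Section FreeModule.
Variables (k : fieldType) (P : choiceType).
Local Notation F := {malg k[P]}.

Definition free_lift (V : lmodType k) (f : P -> V) (g : F) : V :=
  \sum_(p <- msupp g) g@_p *: f p.

Lemma free_liftEw (V : lmodType k) (f : P -> V) (g : F) (d : {fset P}) :
  (msupp g `<=` d)%fset -> free_lift f g = \sum_(p <- d) g@_p *: f p.
Proof.
move=> gd; rewrite /free_lift (big_fset_incl _ gd) // => p _ /mcoeff_outdom ->.
by rewrite scale0r.
Qed.

Lemma free_lift_is_linear (V : lmodType k) (f : P -> V) : linear (free_lift f).
Proof.
move=> c g h; pose d := (msupp (c *: g + h) `|` (msupp g `|` msupp h))%fset.
have d1 : (msupp (c *: g + h) `<=` d)%fset by rewrite fsubsetUl.
have d2 : (msupp g `<=` d)%fset by rewrite fsubsetU // fsubsetUl orbT.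
have d3 : (msupp h `<=` d)%fset by rewrite fsubsetU // fsubsetUr orbT.
rewrite (free_liftEw _ d1) (free_liftEw _ d2) (free_liftEw _ d3).
rewrite scaler_sumr -big_split /=; apply: eq_bigr => p _.
by rewrite mcoeffD mcoeffZ scalerDl scalerA.
Qed.

HB.instance Definition _ (V : lmodType k) (f : P -> V) :=
  GRing.isLinear.Build k F V *:%R (free_lift f) (free_lift_is_linear f).

Lemma free_liftU (V : lmodType k) (f : P -> V) (p : P) :
  free_lift f << p >> = f p.
Proof.
rewrite /free_lift msuppU oner_eq0 big_seq_fset1 mcoeffUU scale1r //.
Qed.

Lemma free_ind (S : set F) : is_subspace S -> (forall p, S << p >>) -> forall g, S g.
Proof.
move=> hS hp g; rewrite [g]monalgE; apply: subspace_sum => // p.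
have -> : << g@_p *g p >> = g@_p *: << p >> :> F.
  by apply/malgP => q; rewrite mcoeffZ !mcoeffU mulrnAr mulr1.
exact: subspaceZ.
Qed.

Variable m : P -> P -> option P.
Hypothesis mA : forall p q r,
  obind (m p) (m q r) = obind (fun s => m s r) (m p q).

Definition free_basis_mul (p q : P) : F := if m p q is Some r then << r >> else 0.

Definition free_mul (x y : F) : F :=
  free_lift (fun p => free_lift (free_basis_mul p) y) x.

Lemma free_mulU p q : free_mul << p >> << q >> = free_basis_mul p q.
Proof. by rewrite /free_mul !free_liftU. Qed.

Lemma free_mulDl : left_distributive free_mul +%R.
Proof. by move=> x y z; rewrite /free_mul linearD. Qed.

Lemma free_mulZl (c : k) x y : free_mul (c *: x) y = c *: free_mul x y.
Proof. by rewrite /free_mul linearZ. Qed.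

Lemma free_mulDr : right_distributive free_mul +%R.
Proof.
move=> x y z; rewrite /free_mul {1 3 5}/free_lift -big_split /=.
by apply: eq_bigr => p _; rewrite linearD scalerDr.
Qed.

Lemma free_mulZr (c : k) x y : free_mul x (c *: y) = c *: free_mul x y.
Proof.
rewrite /free_mul {1 3}/free_lift scaler_sumr.
by apply: eq_bigr => p _; rewrite linearZ /= !scalerA mulrC.
Qed.

Lemma free_mul0l y : free_mul 0 y = 0.
Proof. by rewrite /free_mul linear0. Qed.

Lemma free_mul0r x : free_mul x 0 = 0.
Proof. by have := free_mulZr 0 x 0; rewrite !scale0r. Qed.

Lemma free_mulA : associative free_mul.
Proof.
move=> x y z; pose T (x y z : F) :=
  free_mul x (free_mul y z) = free_mul (free_mul x y) z.
rewrite -/(T x y z); apply: (free_ind (S := fun x => T x y z)).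
  split=> [|c u v]; first by rewrite /T !free_mul0l.
  by rewrite /T !(free_mulDl, free_mulZl) => -> ->.
move=> p; apply: (free_ind (S := fun y => T _ y z)).
  split=> [|c u v]; first by rewrite /T !(free_mul0l, free_mul0r).
  by rewrite /T !(free_mulDl, free_mulZl, free_mulDr, free_mulZr) => -> ->.
move=> q; apply: (free_ind (S := fun z => T _ _ z)).
  split=> [|c u v]; first by rewrite /T !free_mul0r.
  by rewrite /T !(free_mulDr, free_mulZr) => -> ->.
move=> r; rewrite /T !free_mulU /free_basis_mul; have := mA p q r.
case: (m q r) => [s|]; case: (m p q) => [t|] /=;
  rewrite ?(free_mul0l, free_mul0r, free_mulU) // /free_basis_mul.
- by move=> ->.
- by move=> ->.
- by move=> <-.
Qed.

End FreeModule.

Section OmegaPaths.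
Variables (k : fieldType) (D : digraph) (Omega : vertex D -> nuAlgType k).

(* [OCons a p] is the path a x p, where the arrow x is followed by the path p.
   The paths of length 0 from i are the elements of Omega i. Entries may be 0. *)
Inductive opath : vertex D -> vertex D -> Type :=
| OVertex i (a : Omega i) : opath i i
| OCons (x : arrow D) j (a : Omega (source x)) (p : opath (target x) j) :
    opath (source x) j.

Definition opath_lmul i j (a : Omega i) (p : opath i j) : opath i j :=
  match p in opath i j return Omega i -> opath i j with
  | OVertex i b => fun a => OVertex (a ** b)
  | OCons x j b p => fun a => OCons (a ** b) p
  end a.

Fixpoint opath_cat i j l (p : opath i j) : opath j l -> opath i l :=
  match p in opath i j return opath j l -> opath i l with
  | OVertex i a => fun q => opath_lmul a q
  | OCons x j a p => fun q => OCons a (opath_cat p q)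
  end.

Lemma opath_lmulA i j (a b : Omega i) (p : opath i j) :
  opath_lmul (a ** b) p = opath_lmul a (opath_lmul b p).
Proof. by case: p a b => [i' c|x j' c p] a b /=; rewrite numulA. Qed.

Lemma opath_lmul_cat i j l (a : Omega i) (p : opath i j) (q : opath j l) :
  opath_cat (opath_lmul a p) q = opath_lmul a (opath_cat p q).
Proof. by case: p a q => [i' b|x j' b p] a q //=; rewrite opath_lmulA. Qed.

Lemma opath_catA h i j l (p : opath h i) (q : opath i j) (r : opath j l) :
  opath_cat p (opath_cat q r) = opath_cat (opath_cat p q) r.
Proof.
by elim: p q => [h' a|x i' a p IH] q /=; rewrite ?opath_lmul_cat ?IH.
Qed.

(* [opath_add p p1 p2]: the three paths differ in one entry only, where the
   entry of p is the sum of those of p1 and p2. *)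
Inductive opath_add : forall i j, opath i j -> opath i j -> opath i j -> Prop :=
| OAddVertex i (a b : Omega i) :
    opath_add (OVertex (a + b)) (OVertex a) (OVertex b)
| OAddHead x j (a b : Omega (source x)) (p : opath (target x) j) :
    opath_add (OCons (a + b) p) (OCons a p) (OCons b p)
| OAddTail x j (a : Omega (source x)) (p p1 p2 : opath (target x) j) :
    opath_add p p1 p2 -> opath_add (OCons a p) (OCons a p1) (OCons a p2).

(* [opath_scale c p p1]: p is p1 with one entry multiplied by c. *)
Inductive opath_scale (c : k) : forall i j, opath i j -> opath i j -> Prop :=
| OScaleVertex i (a : Omega i) : opath_scale c (OVertex (c *: a)) (OVertex a)
| OScaleHead x j (a : Omega (source x)) (p : opath (target x) j) :
    opath_scale c (OCons (c *: a) p) (OCons a p)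
| OScaleTail x j (a : Omega (source x)) (p p1 : opath (target x) j) :
    opath_scale c p p1 -> opath_scale c (OCons a p) (OCons a p1).

Lemma opath_add_lmul i j (a : Omega i) (p p1 p2 : opath i j) :
  opath_add p p1 p2 ->
  opath_add (opath_lmul a p) (opath_lmul a p1) (opath_lmul a p2).
Proof.
move=> h; elim: h a => {i j p p1 p2} [i b c|x j b c p|x j b p p1 p2 h _] a /=.
- by rewrite numulDr; constructor.
- by rewrite numulDr; constructor.
- by constructor.
Qed.

Lemma opath_scale_lmul c i j (a : Omega i) (p p1 : opath i j) :
  opath_scale c p p1 -> opath_scale c (opath_lmul a p) (opath_lmul a p1).
Proof.
move=> h; elim: h a => {i j p p1} [i b|x j b p|x j b p p1 h _] a /=.
- by rewrite numulZr; constructor.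
- by rewrite numulZr; constructor.
- by constructor.
Qed.

Lemma opath_lmul_add i j (a b : Omega i) (p : opath i j) :
  opath_add (opath_lmul (a + b) p) (opath_lmul a p) (opath_lmul b p).
Proof. by case: p a b => [i' c|x j' c p] a b /=; rewrite numulDl; constructor. Qed.

Lemma opath_lmul_scale c i j (a : Omega i) (p : opath i j) :
  opath_scale c (opath_lmul (c *: a) p) (opath_lmul a p).
Proof. by case: p a => [i' b|x j' b p] a /=; rewrite numulZl; constructor. Qed.

Lemma opath_add_catl i j l (q : opath i j) (p p1 p2 : opath j l) :
  opath_add p p1 p2 ->
  opath_add (opath_cat q p) (opath_cat q p1) (opath_cat q p2).
Proof.
elim: q p p1 p2 => [i' a|x j' a q IH] p p1 p2 h /=; first exact: opath_add_lmul.
by constructor; apply: IH.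
Qed.

Lemma opath_scale_catl c i j l (q : opath i j) (p p1 : opath j l) :
  opath_scale c p p1 -> opath_scale c (opath_cat q p) (opath_cat q p1).
Proof.
elim: q p p1 => [i' a|x j' a q IH] p p1 h /=; first exact: opath_scale_lmul.
by constructor; apply: IH.
Qed.

Lemma opath_add_catr i j l (p p1 p2 : opath i j) (q : opath j l) :
  opath_add p p1 p2 ->
  opath_add (opath_cat p q) (opath_cat p1 q) (opath_cat p2 q).
Proof.
move=> h; elim: h q => {i j p p1 p2} [i a b|x j a b p|x j a p p1 p2 _ IH] q /=.
- exact: opath_lmul_add.
- by constructor.
- by constructor; apply: IH.
Qed.

Lemma opath_scale_catr c i j l (p p1 : opath i j) (q : opath j l) :
  opath_scale c p p1 -> opath_scale c (opath_cat p q) (opath_cat p1 q).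
Proof.
move=> h; elim: h q => {i j p p1} [i a|x j a p|x j a p p1 _ IH] q /=.
- exact: opath_lmul_scale.
- by constructor.
- by constructor; apply: IH.
Qed.

Record gpath := GPath {
  gpath_source : vertex D;
  gpath_target : vertex D;
  gpath_path : opath gpath_source gpath_target
}.

HB.instance Definition _ := gen_eqMixin gpath.
HB.instance Definition _ := gen_choiceMixin gpath.

Definition gpath_cat (p q : gpath) : option gpath :=
  match pselect (gpath_source q = gpath_target p) with
  | left e =>
      Some (GPath (opath_cat (gpath_path p)
        (eq_rect _ (fun v => opath v (gpath_target q)) (gpath_path q) _ e)))
  | right _ => None
  end.

Lemma gpath_catE i j l (p : opath i j) (q : opath j l) :
  gpath_cat (GPath p) (GPath q) = Some (GPath (opath_cat p q)).
Proof.
rewrite /gpath_cat /=; case: pselect => // e.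
by rewrite (Prop_irrelevance e erefl).
Qed.

Lemma gpath_cat_None i j j' l (p : opath i j) (q : opath j' l) :
  j' <> j -> gpath_cat (GPath p) (GPath q) = None.
Proof. by rewrite /gpath_cat /=; case: pselect. Qed.

Lemma gpath_catA p q r :
  obind (gpath_cat p) (gpath_cat q r) = obind (fun s => gpath_cat s r) (gpath_cat p q).
Proof.
case: p q r => [h i p] [i' j q] [j' l r].
case: (pselect (i' = i)) => [e|ne]; case: (pselect (j' = j)) => [e'|ne'].
- by subst i' j'; rewrite !gpath_catE /= !gpath_catE opath_catA.
- by subst i'; rewrite gpath_catE /= !gpath_cat_None.
- by subst j'; rewrite gpath_catE /= !gpath_cat_None.
- by rewrite !gpath_cat_None.
Qed.

Definition path_space : Type := {malg k[gpath]}.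
HB.instance Definition _ := GRing.Lmodule.on path_space.
HB.instance Definition _ := Lmodule_isNuAlgebra.Build k path_space
  (free_mulA gpath_catA) (@free_mulDl k gpath gpath_cat)
  (@free_mulDr k gpath gpath_cat) (@free_mulZl k gpath gpath_cat)
  (@free_mulZr k gpath gpath_cat).

Definition path_vec i j (p : opath i j) : path_space := mkmalgU (GPath p) 1.

(* The relations that make paths multilinear in their entries; the case c = 0
   of the second family kills the paths with a zero entry, and on the paths of
   length 0 from i to i they leave exactly the space Omega i. *)
Definition multilinear_rel : set path_space := fun z =>
  (exists i j (p p1 p2 : opath i j),
     opath_add p p1 p2 /\ z = path_vec p - (path_vec p1 + path_vec p2)) \/
  (exists i j (c : k) (p p1 : opath i j),
     opath_scale c p p1 /\ z = path_vec p - c *: path_vec p1).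

Lemma path_vecM i j l (p : opath i j) (q : opath j l) :
  path_vec p ** path_vec q = path_vec (opath_cat p q).
Proof. by rewrite /path_vec [LHS]free_mulU /free_basis_mul gpath_catE. Qed.

Lemma path_vecM0 i j j' l (p : opath i j) (q : opath j' l) :
  j' <> j -> path_vec p ** path_vec q = 0.
Proof. by move=> ne; rewrite [LHS]free_mulU /free_basis_mul gpath_cat_None. Qed.

Lemma path_space_ind (S : set path_space) : is_subspace S ->
  (forall i j (p : opath i j), S (path_vec p)) -> forall z, S z.
Proof. by move=> hS hp; apply: free_ind => // -[i j p]; apply: hp. Qed.

Lemma multilinear_is_ideal : is_ideal (span multilinear_rel).
Proof.
set K := span _; have sK : is_subspace K by exact: span_subspace.
split=> // a z Kz.
apply: (path_space_ind (S := fun a => K (a ** z) /\ K (z ** a))).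
  split=> [|c u v [h1 h2] [h3 h4]].
    by rewrite numul0r numulr0; split; exact: sK.1.
  by rewrite numulDl numulDr numulZl numulZr; split; exact: sK.2.
move=> i j q; apply: (Kz (fun z => K (path_vec q ** z) /\ K (z ** path_vec q))).
  split=> [|c u v [h1 h2] [h3 h4]].
    by rewrite numul0r numulr0; split; exact: sK.1.
  by rewrite numulDl numulDr numulZl numulZr; split; exact: sK.2.
move=> {z Kz} _ [[i' [l [p [p1 [p2 [h ->]]]]]]|[i' [l [c [p [p1 [h ->]]]]]]].
- rewrite numulBl numulBr numulDl numulDr; split.
    case: (pselect (i' = j)) => [e|ne]; last first.
      by rewrite !path_vecM0 // addr0 subrr; exact: sK.1.
    subst i'; rewrite !path_vecM; apply: sub_span; left.
    by do 5!eexists; split; [exact: (opath_add_catl q h)|].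
  case: (pselect (i = l)) => [e|ne]; last first.
    by rewrite !path_vecM0 // addr0 subrr; exact: sK.1.
  subst i; rewrite !path_vecM; apply: sub_span; left.
  by do 5!eexists; split; [exact: (opath_add_catr q h)|].
- rewrite numulBl numulBr numulZl numulZr; split.
    case: (pselect (i' = j)) => [e|ne]; last first.
      by rewrite !path_vecM0 // scaler0 subrr; exact: sK.1.
    subst i'; rewrite !path_vecM; apply: sub_span; right.
    by do 5!eexists; split; [exact: (opath_scale_catl q h)|].
  case: (pselect (i = l)) => [e|ne]; last first.
    by rewrite !path_vecM0 // scaler0 subrr; exact: sK.1.
  subst i; rewrite !path_vecM; apply: sub_span; right.
  by do 5!eexists; split; [exact: (opath_scale_catr q h)|].
Qed.

Definition gpa : nuAlgType k := quotalg (Ideal multilinear_is_ideal).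

Definition gpa_path i j (p : opath i j) : gpa :=
  quot_proj (Ideal multilinear_is_ideal) (path_vec p).

(* An arrow x from i to j is identified with the path e_i x e_j. *)
Definition gpa_arrows : set gpa := fun z =>
  exists (x : arrow D) (e : Omega (source x)) (f : Omega (target x)),
    [/\ is_unity e, is_unity f & z = gpa_path (OCons e (OVertex f))].

Definition arrow_ideal : ideal gpa := ideal_gen gpa_arrows.

(* The standing assumptions on D and Omega. *)
Definition gpa_data : Prop :=
  [/\ inhabited (vertex D), forall i, has_nonzero_unity (Omega i)
    & forall i, jacobson_set (A := Omega i) = [set 0]].

Definition weak_relations (rho : set gpa) : Prop :=
  rho !=set0 /\
  exists2 t, (0 < t)%N &
    ideal_pow arrow_ideal t `<=` ideal_gen rho /\
    ideal_gen rho `<=` arrow_ideal.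

Definition gpa_rel (rho : set gpa) : nuAlgType k := quotalg (ideal_gen rho).

End OmegaPaths.

(* Main.v *)
From HB Require Import structures.
From mathcomp Require Import all_boot all_algebra falgebra separable.
From mathcomp Require Import boolp classical_sets cardinality.
Require Import Defs.

Set Implicit Arguments.
Unset Strict Implicit.
Unset Printing Implicit Defensive.

Import GRing.Theory.
Local Open Scope ring_scope.
Local Open Scope classical_set_scope.

(** Let r be the radical of L. Everything rests on Wedderburn's principal theorem
    ([wedderburn_principal]): over a perfect field the projection L -> L / r has a
    multiplicative section. If L / r is a direct sum of non-zero algebras B i, take
    these as the vertex algebras and put enough arrows between any two vertices to
    reach a spanning family of r; the path algebra then maps onto L
    ([path_algebra_presentation]), its arrow ideal J maps into the nilpotent r, and
    the kernel is contained in J because the vertex part is mapped injectively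
    modulo r. The kernel is thus a set of weak relations. The first part follows
    with the single summand L / r, the second with the given simple summands, the
    third with sums of simple summands. Conversely,
    J^t is in the ideal of the relations, so paths of bounded length span the
    quotient ([findim_gpa_rel]), and its unity is not 0 because that ideal is inside
    J ([gpa_rel_unity]).

    For the principal theorem let Q = L / r. In Q the maximal left ideals intersect
    in 0, so every two-sided ideal is generated by a central idempotent
    ([ideals_have_unity_of_right]) and every sub-bimodule of a power of Q is a direct
    summand, cut out by a projector with central entries ([bimodule_projector]). The
    centre is reduced, so its elements are annihilated by separable polynomials,
    which yields a separability idempotent of the centre ([center_separable]). A
    density argument with the projectors extends it to a separability idempotent of
    Q ([exists_separability_idempotent]). Finally a linear section f of L -> Q whose
    defect f a * f b - f (a * b) lies in r^n is corrected, by contracting this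
    2-cocycle with the separability idempotent, to one whose defect lies in r^(n+1)
    ([lift_step]); as r is nilpotent this ends with a multiplicative section. *)

(** * Subspaces and finite dimension *)

Lemma bijective_inj_surj (T U : Type) (f : T -> U) :
  injective f -> (forall y, exists x, f x = y) -> bijective f.
Proof.
move=> finj fsurj; pose g y := sval (cid (fsurj y)).
have gK y : f (g y) = y by rewrite /g; case: cid.
by exists g => // x; apply: finj; rewrite gK.
Qed.

Section Subspaces.
Variables (k : fieldType) (V : vectType k).

Lemma vspace_max (P : {vspace V} -> Prop) : (exists U, P U) ->
  exists2 U, P U & forall W, P W -> (U <= W)%VS -> W = U.
Proof.
move=> exP; pose Q n := `[< exists2 U, P U & \dim U = n >].
have exQ : exists n, Q n by have [U PU] := exP; exists (\dim U); apply/asboolP; exists U.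
have ubQ n : Q n -> (n <= \dim {:V})%N.
  by move=> /asboolP[U _ <-]; apply/dimvS/subvf.
have [m /asboolP[U PU Um] mmax] := ex_maxnP exQ ubQ.
exists U => // W PW UW; apply/esym/eqP; rewrite eqEdim UW Um.
by apply: mmax; apply/asboolP; exists W.
Qed.

Lemma vspace_min (P : {vspace V} -> Prop) : (exists U, P U) ->
  exists2 U, P U & forall W, P W -> (W <= U)%VS -> W = U.
Proof.
move=> exP; pose Q n := `[< exists2 U, P U & \dim U = n >].
have exQ : exists n, Q n by have [U PU] := exP; exists (\dim U); apply/asboolP; exists U.
have [m /asboolP[U PU Um] mmin] := ex_minnP exQ.
exists U => // W PW WU; apply/eqP; rewrite eqEdim WU Um.
by apply: mmin; apply/asboolP; exists W.
Qed.

Lemma subspace_vspace (S : set V) : is_subspace S ->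
  exists U : {vspace V}, forall x, x \in U <-> S x.
Proof.
move=> sS; have [|U US Umax] := @vspace_max (fun U => forall x, x \in U -> S x).
  by exists 0%VS => x; rewrite memv0 => /eqP ->; exact: sS.1.
exists U => x; split=> [/US //|Sx].
rewrite -(Umax (U + <[x]>)%VS) ?addvSl //; last first.
  move=> y /memv_addP[u Uu [_ /vlineP[c ->] ->]].
  by apply: subspaceD; [|exact: US|exact: subspaceZ].
by rewrite memvE addvSr.
Qed.

(** A lattice of subspaces whose maximal members separate the vectors from 0
    is complemented: if C is minimal with N + C the whole space, a non-zero x in
    both N and C is avoided by some maximal M, and C :&: M still works. *)
Lemma complemented_of_maximal (P : {vspace V} -> Prop) :
  P fullv -> (forall U W, P U -> P W -> P (U :&: W)%VS) ->
  (forall x, x != 0 -> exists M, [/\ P M, x \notin M &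
     forall N, P N -> ~~ (N <= M)%VS -> (N + M)%VS = fullv]) ->
  forall N, P N -> exists C, [/\ P C, (N :&: C)%VS = 0%VS & (N + C)%VS = fullv].
Proof.
move=> Pf PI Pmax N PN.
have [|C [PC NC] Cmin] := @vspace_min (fun C => P C /\ (N + C)%VS = fullv).
  by exists fullv; split=> //; apply/eqP; rewrite eqEsubv subvf addvSr.
exists C; split=> //; apply/eqP; apply: contraT => ncap0.
have x0 := ncap0; rewrite -vpick0 in x0; have := memv_pick (N :&: C)%VS.
move: (vpick _) x0 => x x0 /[!memv_cap] /andP[Nx Cx].
have [M [PM Mx Mmax]] := Pmax x x0.
have NCM : ((N :&: C) + M)%VS = fullv.
  apply: Mmax; first exact: PI.
  by apply: contra Mx => /subvP; apply; rewrite memv_cap Nx.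
have eC : (C :&: M)%VS = C.
  apply: Cmin; last exact: capvSl.
  split; first exact: PI.
  apply/eqP; rewrite eqEsubv subvf -NC subv_add addvSl /=; apply/subvP => c Cc.
  have /memv_addP[y + [m Mm ec]] : c \in ((N :&: C) + M)%VS by rewrite NCM memvf.
  rewrite memv_cap => /andP[Ny Cy]; rewrite ec memv_add // memv_cap Mm andbT.
  by have -> : m = c - y; rewrite ?memvB // ec addrC addKr.
by case/negP: Mx; move: Cx; rewrite -eC memv_cap => /andP[].
Qed.

End Subspaces.

Section FiniteDimension.
Variables (k : fieldType).
Implicit Types V : lmodType k.

Lemma findim_vectType V : findim V ->
  exists (W : vectType k) (f : {linear W -> V}) (g : {linear V -> W}),
    cancel f g /\ cancel g f.
Proof.
case=> n [ax]; pose W : vectType k := HB.pack (GRing.Lmodule.sort V)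
  (Lmodule_hasFinDim.Build k V ax).
by exists W, (idfun : {linear V -> V}), (idfun : {linear V -> V}).
Qed.

Lemma findim_bij V (W : vectType k) (f : {linear W -> V}) : bijective f -> findim V.
Proof.
case=> g fK gK; exists (dim W); constructor; exists (VectorInternalTheory.v2r \o g).
  have [v2rZ v2rD] := v2r_semilinear (VectorInternalTheory.v2r_subproof W).
  move=> c x y /=; rewrite /VectorInternalTheory.v2r -v2rZ -v2rD; congr (v2r _).
  by apply: (can_inj fK); rewrite linearP !gK.
exists (f \o VectorInternalTheory.r2v) => x /=.
  by rewrite VectorInternalTheory.v2rK.
by rewrite fK VectorInternalTheory.r2vK.
Qed.

Lemma findim_surj_vect V (W : vectType k) (f : {linear W -> V}) :
  (forall y, exists x, f x = y) -> findim V.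
Proof.
move=> fsurj; have [|K KE] := @subspace_vspace k W (fun x => f x = 0).
  by split=> [|c u v fu fv]; rewrite ?linear0 // linearP fu fv scaler0 addr0.
pose g : {linear subvs_of K^C -> V} := f \o vsval.
apply: (@findim_bij _ _ g); apply/bijective_inj_surj => [x y gxy|y].
  apply/subvs_inj/eqP; rewrite -subr_eq0 -memv0 -(capv_compl K) memv_cap.
  apply/andP; split; last by rewrite memvB ?subvsP.
  by apply/KE; rewrite linearB /=; move: gxy; rewrite /g /= => ->; rewrite subrr.
have [x <-] := fsurj y; have : x \in (K + K^C)%VS by rewrite addv_complf memvf.
case/memv_addP=> u /KE fu [v Cv ->]; exists (Subvs Cv) => //.
by rewrite /g /= linearD fu add0r.
Qed.

Lemma findim_surj V V' (f : {linear V' -> V}) :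
  (forall y, exists x, f x = y) -> findim V' -> findim V.
Proof.
move=> fsurj /findim_vectType[W [h [h' [_ h'K]]]].
apply: (@findim_surj_vect _ _ (f \o h)) => y; have [x <-] := fsurj y.
by exists (h' x); rewrite /= h'K.
Qed.

Lemma findim_inj V V' (f : {linear V -> V'}) : injective f -> findim V' -> findim V.
Proof.
move=> finj /findim_vectType[W [h [h' [_ /can_inj h'inj]]]].
have [|U UE] := @subspace_vspace k W (fun y => exists x, h' (f x) = y).
  split; first by exists 0; rewrite !linear0.
  by move=> c _ _ [x <-] [y <-]; exists (c *: x + y); rewrite !linearP.
have invP (y : subvs_of U) : {x | h' (f x) = vsval y}.
  by apply/cid/UE/subvsP.
pose g y := sval (invP y); have gK y : h' (f (g y)) = vsval y := svalP (invP y).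
have g_lin : linear g.
  by move=> c u v; apply: finj; apply: h'inj; rewrite !linearP !gK.
pose gL : {linear subvs_of U -> V} := HB.pack g (GRing.isLinear.Build _ _ _ _ _ g_lin).
apply: (@findim_surj_vect _ _ gL) => x.
have fxU : h' (f x) \in U by apply/UE; exists x.
by exists (Subvs fxU); apply: finj; apply: h'inj; rewrite [h' _]gK.
Qed.

End FiniteDimension.

Section FinitelySpanned.
Variables (k : fieldType) (V : lmodType k).
Implicit Types (S X : set V).

Definition fin_spanned S : Prop := exists r : seq V, S `<=` span [set y | y \in r].

Lemma span_min S X : is_subspace S -> X `<=` S -> span X `<=` S.
Proof. by move=> sS XS x; apply. Qed.

Lemma spanS X Y : X `<=` Y -> span X `<=` span Y.
Proof.
by move=> XY; apply: span_min => [|x /XY]; [exact: span_subspace | exact: sub_span].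
Qed.

Lemma fin_spanned_findim : fin_spanned setT -> findim V.
Proof.
case=> r rP; pose f (u : 'rV[k]_(size r)) := \sum_t u 0 t *: r`_t.
have f_lin : linear f.
  move=> c u v; rewrite /f scaler_sumr -big_split /=; apply: eq_bigr => t _.
  by rewrite !mxE scalerDl scalerA.
pose fL : {linear 'rV[k]_(size r) -> V} := HB.pack f (GRing.isLinear.Build _ _ _ _ _ f_lin).
apply: (@findim_surj_vect k V _ fL) => v.
apply: (rP v I (fun v => exists x, fL x = v)) => [|y /= ry].
  split; first by exists 0; rewrite linear0.
  by move=> c _ _ [x <-] [y <-]; exists (c *: x + y); rewrite linearP.
have ltr : (index y r < size r)%N by rewrite index_mem.
exists (delta_mx 0 (Ordinal ltr)); rewrite /fL /= /f (bigD1 (Ordinal ltr)) //= big1.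
  by rewrite addr0 mxE !eqxx scale1r nth_index.
by move=> t /negPf nt; rewrite mxE nt andbF scale0r.
Qed.

Lemma fin_spanned_sub S S' : S `<=` S' -> fin_spanned S' -> fin_spanned S.
Proof. by move=> SS' [r rP]; exists r => x /SS' /rP. Qed.

Lemma fin_spanned_span S : fin_spanned S -> fin_spanned (span S).
Proof. by case=> r rP; exists r; apply: span_min => //; exact: span_subspace. Qed.

Lemma fin_spanned1 x : fin_spanned [set x].
Proof. by exists [:: x] => _ ->; apply: sub_span; rewrite /= inE. Qed.

Lemma fin_spannedU S S' : fin_spanned S -> fin_spanned S' -> fin_spanned (S `|` S').
Proof.
move=> [r rP] [r' r'P]; exists (r ++ r') => x [/rP|/r'P]; apply: spanS => y /=;
by rewrite mem_cat => ->; rewrite ?orbT.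
Qed.

Lemma fin_spanned_family n (S : 'I_n -> set V) :
  (forall i, fin_spanned (S i)) -> fin_spanned (fun x => exists i, S i x).
Proof.
move=> fS; pose r i := sval (cid (fS i)).
exists (flatten [seq r i | i <- enum 'I_n]) => x [i].
have rP : S i `<=` span [set y | y \in r i] by rewrite /r; case: cid.
move/rP; apply: spanS => y /= ry; apply/flattenP; exists (r i) => //.
by apply: map_f; rewrite mem_enum.
Qed.

End FinitelySpanned.

Lemma fin_spanned_image (k : fieldType) (V V' : lmodType k) (f : {linear V -> V'}) S :
  fin_spanned S -> fin_spanned (f @` S).
Proof.
case=> r rP; exists (map f r) => _ [x /rP Sx <-].
apply: (Sx (fun x => span [set y | y \in map f r] (f x))) => [|y ry].
  have [s0 sP] := @span_subspace k V' [set y | y \in map f r].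
  by split=> [|c u v Su Sv]; rewrite ?linear0 // linearP; exact: sP.
by apply: sub_span; exact: map_f.
Qed.

Lemma findim_fin_spanned (k : fieldType) (V : lmodType k) : findim V -> fin_spanned [set: V].
Proof.
move=> /findim_vectType[W [f [g [fK gK]]]].
rewrite (_ : setT = f @` setT); last first.
  by apply/seteqP; split=> // x _; exists (g x).
apply: fin_spanned_image; exists (vbasis {:W}) => w _.
have sS := @span_subspace k W [set y | y \in vbasis {:W}].
rewrite (coord_vbasis (memvf w)); apply: (subspace_sum _ sS) => i.
by apply: (subspaceZ _ sS); apply: sub_span; apply: mem_nth; rewrite size_tuple.
Qed.

(** * Two-sided ideals of a semisimple algebra *)

Section IdealsOfAlgebra.
Variables (k : fieldType) (Q : falgType k).
Implicit Types (U I M N : {vspace Q}) (a b c x y z : Q).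

Definition left_ideal_vs U : Prop := forall a x, x \in U -> a * x \in U.

Definition ideal_vs U : Prop :=
  forall a x, x \in U -> a * x \in U /\ x * a \in U.

Definition central z : Prop := forall a, a * z = z * a.

Definition ideals_have_unity : Prop := forall I, ideal_vs I ->
  exists c, [/\ c \in I, central c & forall x, x \in I -> c * x = x].

(** This is semisimplicity of the regular left module: the maximal left ideals
    intersect in 0, so every left ideal N has a complement C, and the component
    in N of 1 = n + c acts on N as the identity from the right, since
    x - x * n = x * c lies in both N and C. *)
Lemma left_ideal_right_unity :
  (forall x, x != 0 -> exists M, [/\ left_ideal_vs M, x \notin M &
     forall N, left_ideal_vs N -> (M <= N)%VS -> N = M \/ N = fullv]) ->
  forall N, left_ideal_vs N -> exists2 e, e \in N & forall x, x \in N -> x * e = x.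
Proof.
move=> Qmax N lN.
have [| | |C [lC NC0 NCT]] := @complemented_of_maximal k Q left_ideal_vs _ _ _ N lN.
- by move=> a x _; exact: memvf.
- move=> U W lU lW a x; rewrite !memv_cap => /andP[Ux Wx].
  by rewrite lU // lW.
- move=> x /Qmax[M [lM Mx Mmax]]; exists M; split=> // N' lN' N'M.
  have [|||] := Mmax (N' + M)%VS; last by [].
  + move=> a _ /memv_addP[u Nu [v Mv ->]].
    by rewrite mulrDr memv_add // ?lN' ?lM.
  + exact: addvSr.
  + by move=> E; case/negP: N'M; rewrite -E addvSl.
have /memv_addP[n Nn [c Cc e1]] : 1 \in (N + C)%VS by rewrite NCT memvf.
exists n => // x Nx; apply/eqP; rewrite eq_sym -subr_eq0 -memv0 -NC0 memv_cap.
rewrite memvB ?lN //= -{1}[x]mulr1 e1 mulrDr addrC addKr; exact: lC.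
Qed.

(** A right unity n of an ideal I is also a left unity: the elements
    j = n * x - x satisfy I * j = 0, while a right unity q * j of the left ideal
    Q * j gives j = j * (q * j), a member of I * j. *)
Lemma ideals_have_unity_of_right :
  (forall N, left_ideal_vs N -> exists2 e, e \in N & forall x, x \in N -> x * e = x) ->
  ideals_have_unity.
Proof.
move=> Qr I iI; have [|n In nP] := Qr I; first by move=> a x /(iI a)[].
have nl x : x \in I -> n * x = x.
  move=> Ix; apply/eqP; rewrite -subr_eq0; apply/eqP; set j := n * x - x.
  have Ij : j \in I by rewrite memvB // (iI n x Ix).1.
  have I0 y : y \in I -> y * j = 0.
    by move=> Iy; rewrite mulrBr mulrA nP // subrr.
  have [|m /memv_imgP[q _ ->]] := Qr (limg (amulr j)).
    move=> a _ /memv_imgP[q _ ->]; rewrite lfunE /= mulrA.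
    by apply/memv_imgP; exists (a * q); rewrite ?memvf // lfunE.
  rewrite lfunE /= => /(_ j) <-; last first.
    by apply/memv_imgP; exists 1; rewrite ?memvf // lfunE /= mul1r.
  by rewrite mulrA I0 // (iI q j Ij).2.
exists n; split=> // a.
have [Ina Ian] := iI a n In.
by rewrite -[a * n]nl // mulrA nP.
Qed.

Hypothesis Qunity : ideals_have_unity.

(** If z * z = 0 with z central, the unity q * z of the ideal Q * z satisfies
    z = (q * z) * z = 0. *)
Lemma central_reduced z : central z -> z * z = 0 -> z = 0.
Proof.
move=> cz zz; have [|c [/memv_imgP[q _ ->] _]] := @Qunity (limg (amulr z)).
  move=> a _ /memv_imgP[q _ ->]; rewrite lfunE /=; split.
    by apply/memv_imgP; exists (a * q); rewrite ?memvf // lfunE /= mulrA.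
  by apply/memv_imgP; exists (q * a); rewrite ?memvf // lfunE /= -!mulrA cz.
rewrite lfunE /= => /(_ z) <-; last first.
  by apply/memv_imgP; exists 1; rewrite ?memvf // lfunE /= mul1r.
by rewrite -mulrA zz mulr0.
Qed.

(** If c is the unity of the ideal generated by x, a maximal ideal through 1 - c
    that misses c also misses x. *)
Lemma ideal_maximal x : x != 0 -> exists M, [/\ ideal_vs M, x \notin M &
  forall N, ideal_vs N -> ~~ (N <= M)%VS -> (N + M)%VS = fullv].
Proof.
move=> x0; pose I := ({:Q} * <[x]> * {:Q})%VS.
have iI : ideal_vs I.
  move=> a y Iy; split.
    have : a * y \in ({:Q} * I)%VS by rewrite memv_mul ?memvf.
    by apply/subvP; rewrite /I -!prodvA [X in (X <= _)%VS]prodvA prodvSl ?subvf.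
  have : y * a \in (I * {:Q})%VS by rewrite memv_mul ?memvf.
  by apply/subvP; rewrite /I -!prodvA !prodvSr ?subvf.
have Ix : x \in I.
  by rewrite -[x]mulr1 -[x]mul1r !memv_mul ?memvf // memv_line.
have [c [Ic cc cP]] := Qunity iI.
have c_idem : c * c = c := cP c Ic.
have c0 : c != 0 by apply: contraNneq x0 => c0; rewrite -[x]cP // c0 mul0r.
pose P M := [/\ ideal_vs M, 1 - c \in M & c \notin M].
have [|M [iM M1 Mc] Mmax] := @vspace_max k Q P.
  exists (limg (amull (1 - c))); split.
  - move=> a _ /memv_imgP[q _ ->]; rewrite lfunE /=; split.
      apply/memv_imgP; exists (a * q); rewrite ?memvf // lfunE /=.
      by rewrite !mulrA mulrBr mulr1 cc !mulrBl mul1r.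
    by apply/memv_imgP; exists (q * a); rewrite ?memvf // lfunE /= mulrA.
  - by apply/memv_imgP; exists 1; rewrite ?memvf // lfunE /= mulr1.
  - apply: contra c0 => /memv_imgP[q _]; rewrite lfunE /= => e.
    by rewrite -c_idem {2}e mulrA mulrBr mulr1 c_idem subrr mul0r.
have ideal_add N : ideal_vs N -> ideal_vs (N + M)%VS.
  move=> iN a _ /memv_addP[u Nu [v Mv ->]].
  by rewrite mulrDr mulrDl !memv_add ?(iN a u Nu).1 ?(iN a u Nu).2
             ?(iM a v Mv).1 ?(iM a v Mv).2.
have one_in N : ideal_vs N -> ~~ (N <= M)%VS -> (N + M)%VS = fullv.
  move=> iN NM; have iNM := ideal_add N iN.
  have cNM : c \in (N + M)%VS.
    apply: contraT => cNM; case/negP: NM; rewrite -(Mmax (N + M)%VS) ?addvSl ?addvSr //.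
    by split=> //; rewrite (subvP (addvSr N M)).
  have NM1 : 1 \in (N + M)%VS.
    by rewrite -[1](subrK c) memvD // (subvP (addvSr N M)).
  apply/eqP; rewrite eqEsubv subvf; apply/subvP => q _.
  by rewrite -[q]mulr1 (iNM q 1 NM1).1.
(* an ideal through x contains the ideal generated by x, hence c *)
exists M; split=> //; apply: contra Mc => Mx.
have /subvP IM : (I <= M)%VS; last exact: IM.
apply/prodvP => y v Qxy _; suff My : y \in M by rewrite (iM v y My).2.
move: y Qxy; apply/subvP/prodvP => u w _ /vlineP[t ->].
by rewrite -scalerAr memvZ // (iM u x Mx).1.
Qed.

End IdealsOfAlgebra.

(** * Sub-bimodules of the powers of an algebra *)

Section Bimodules.
Variables (k : fieldType) (Q : falgType k).
Hypothesis Qunity : ideals_have_unity Q.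
Variable m : nat.
Local Notation V := {ffun 'I_m -> Q}.
Implicit Types (N C : {vspace V}) (v : V) (a : Q).

Definition lact a v : V := [ffun i => a * v i].
Definition ract v a : V := [ffun i => v i * a].

Definition bimodule_vs N : Prop := forall a v, v \in N -> lact a v \in N /\ ract v a \in N.

(** A tuple with a non-zero entry v i is avoided by the sub-bimodule of the
    tuples whose i-th entry lies in a maximal ideal that misses v i. *)
Lemma bimodule_complement N : bimodule_vs N ->
  exists C, [/\ bimodule_vs C, (N :&: C)%VS = 0%VS & (N + C)%VS = fullv].
Proof.
move: N; apply: complemented_of_maximal.
- by move=> a v _; rewrite !memvf.
- move=> U W bU bW a v; rewrite !memv_cap => /andP[Uv Wv].
  by rewrite (bU a v Uv).1 (bU a v Uv).2 (bW a v Wv).1 (bW a v Wv).2.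
move=> v v0; have [i vi0] : exists i, v i != 0.
  apply: contrapT => nv; case/eqP: v0; apply/ffunP => i; rewrite ffunE.
  by apply: contrapT => /eqP vi0; apply: nv; exists i.
have [M [iM Mvi Mmax]] := ideal_maximal Qunity vi0.
have [|M' M'E] := @subspace_vspace k V (fun w => w i \in M).
  split=> [|c u w Mu Mw]; first by rewrite ffunE mem0v.
  by rewrite !ffunE memvD ?memvZ.
exists M'; split; last 1 first.
- move=> N bN NM'; have [|I IE] := @subspace_vspace k Q (fun x => exists2 w, w \in N & w i = x).
    split; first by exists 0; rewrite ?mem0v ?ffunE.
    move=> c _ _ [u Nu <-] [w Nw <-]; exists (c *: u + w); first by rewrite memvD ?memvZ.
    by rewrite !ffunE.
  have IM : (I + M)%VS = fullv.
    apply: Mmax.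
      move=> a _ /IE[w Nw <-]; split; apply/IE.
        by exists (lact a w); [case: (bN a w Nw) | rewrite ffunE].
      by exists (ract w a); [case: (bN a w Nw) | rewrite ffunE].
    apply: contra NM' => /subvP IM; apply/subvP => w Nw; apply/M'E/IM/IE.
    by exists w.
  apply/eqP; rewrite eqEsubv subvf; apply/subvP => w _.
  have /memv_addP[_ /IE[n Nn <-] [x Mx ewi]] : w i \in (I + M)%VS by rewrite IM memvf.
  rewrite -[w](subrK n) addrC memv_add //; apply/M'E.
  by rewrite !ffunE ewi addrC addKr.
- move=> a w /M'E Mw; have [Maw Mwa] := iM a _ Mw.
  by split; apply/M'E; rewrite ffunE.
- by apply: contra Mvi => /M'E.
Qed.

(** The projection onto N along a complementary sub-bimodule commutes with both
    actions, so it is given by the images of the unit vectors, whose entries are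
    central because the unit vectors commute with Q. *)
Lemma bimodule_projector N : bimodule_vs N ->
  exists z : 'I_m -> V, [/\ forall s, z s \in N, forall s r, central (z s r)
    & forall v, v \in N -> forall r, v r = \sum_s v s * z s r].
Proof.
move=> bN; have [C [bC NC0 NCT]] := bimodule_complement bN.
pose unit_vec s : V := [ffun r => (r == s)%:R].
have dec s : exists n, n \in N /\ unit_vec s - n \in C.
  have /memv_addP[n Nn [c Cc e]] : unit_vec s \in (N + C)%VS by rewrite NCT memvf.
  by exists n; rewrite e addrC addKr.
pose z s := sval (cid (dec s)).
have zN s : z s \in N by rewrite /z; case: cid => n [].
have zC s : unit_vec s - z s \in C by rewrite /z; case: cid => n [].
have NC_eq v w : v \in N -> w \in N -> w - v \in C -> w = v.
  move=> Nv Nw Cwv; apply/eqP; rewrite -subr_eq0 -memv0 -NC0 memv_cap Cwv.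
  by rewrite memvB.
exists z; split=> // [s r a|v Nv r].
  suff : lact a (z s) = ract (z s) a by move/ffunP/(_ r); rewrite !ffunE.
  apply: NC_eq; [by case: (bN a _ (zN s)) | by case: (bN a _ (zN s)) |].
  have [Cl Cr] := bC a _ (zC s).
  have -> : lact a (z s) - ract (z s) a
    = ract (unit_vec s - z s) a - lact a (unit_vec s - z s).
    apply/ffunP => i; rewrite !ffunE mulrBr mulrBl.
    have -> : a * (i == s)%:R = (i == s)%:R * a by rewrite mulr_natr mulr_natl.
    by rewrite opprB [RHS]addrC addrA subrK.
  exact: memvB.
have sum_unit : v = \sum_s lact (v s) (unit_vec s).
  apply/ffunP => i; rewrite sum_ffunE (bigD1 i) //= big1 ?addr0 => [|s /negPf si].
    by rewrite !ffunE eqxx mulr1.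
  by rewrite !ffunE eq_sym si mulr0.
have ev : v = \sum_s lact (v s) (z s).
  apply: NC_eq => //; first by apply: memv_suml => s _; case: (bN (v s) _ (zN s)).
  rewrite {1}sum_unit -sumrB; apply: memv_suml => s _.
  have -> : lact (v s) (unit_vec s) - lact (v s) (z s) = lact (v s) (unit_vec s - z s).
    by apply/ffunP => i; rewrite !ffunE mulrBr.
  by case: (bC (v s) _ (zC s)).
by rewrite {1}ev sum_ffunE; apply: eq_bigr => s _; rewrite ffunE.
Qed.

End Bimodules.

(** * Tensors and separability *)

Section BilinearMaps.
Variables (k : fieldType) (Q : lmodType k).

Definition bilin (V : lmodType k) (b : Q -> Q -> V) : Prop :=
  (forall x, linear (b x)) /\ (forall y, linear (b^~ y)).

Variables (V : lmodType k) (b : Q -> Q -> V).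
Hypothesis bP : bilin b.

Let bl y : {linear Q -> V} := HB.pack (b^~ y) (GRing.isLinear.Build _ _ _ _ _ (bP.2 y)).
Let br x : {linear Q -> V} := HB.pack (b x) (GRing.isLinear.Build _ _ _ _ _ (bP.1 x)).

Lemma bilin_suml I (r : seq I) F y : b (\sum_(i <- r) F i) y = \sum_(i <- r) b (F i) y.
Proof. exact: (linear_sum (bl y)). Qed.
Lemma bilin_sumr I (r : seq I) F x : b x (\sum_(i <- r) F i) = \sum_(i <- r) b x (F i).
Proof. exact: (linear_sum (br x)). Qed.
Lemma bilinDl x x' y : b (x + x') y = b x y + b x' y.
Proof. exact: (linearD (bl y)). Qed.
Lemma bilinDr x y y' : b x (y + y') = b x y + b x y'.
Proof. exact: (linearD (br x)). Qed.
Lemma bilinNl x y : b (- x) y = - b x y.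
Proof. exact: (linearN (bl y)). Qed.
Lemma bilinZl c x y : b (c *: x) y = c *: b x y.
Proof. exact: (linearZ_LR (bl y)). Qed.
Lemma bilinZr c x y : b x (c *: y) = c *: b x y.
Proof. exact: (linearZ_LR (br x)). Qed.
Lemma bilin0l y : b 0 y = 0.
Proof. exact: (linear0 (bl y)). Qed.
Lemma bilin0r x : b x 0 = 0.
Proof. exact: (linear0 (br x)). Qed.

Lemma bilin_comp (f g : Q -> Q) : linear f -> linear g -> bilin (fun x y => b (f x) (g y)).
Proof.
by move=> fl gl; split=> [x|y] c u v; rewrite ?fl ?gl ?bilinDl ?bilinDr ?bilinZl ?bilinZr.
Qed.

End BilinearMaps.

(** A tensor in Q (x) Q is represented by a sequence of pairs, and an identity
    between tensors by its instances under all bilinear maps. *)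
Definition tens_eval (k : fieldType) (Q V : lmodType k) (s : seq (Q * Q))
  (b : Q -> Q -> V) : V := \sum_(p <- s) b p.1 p.2.

Lemma mull_linear (k : fieldType) (Q : algType k) (a : Q) : linear ( *%R a).
Proof. by move=> c u v; rewrite mulrDr scalerAr. Qed.

Lemma mulr_linear (k : fieldType) (Q : algType k) (a : Q) : linear ( *%R^~ a).
Proof. by move=> c u v; rewrite mulrDl scalerAl. Qed.

Lemma exists_irreducible_factor (k : fieldType) (g : {poly k}) : (1 < size g)%N ->
  exists2 q, irreducible_poly q & q %| g.
Proof.
have [n] := ubnP (size g); elim: n g => // n IH g /ltnSE gn g1.
have [gi|gni] := EM (irreducible_poly g); first by exists g.
have [q [q1 qg qng]] : exists q : {poly k}, [/\ size q != 1%N, q %| g & ~~ (q %= g)].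
  apply: contrapT => nq; apply: gni; split=> // q q1 qg.
  by apply: contrapT => /negP qng; apply: nq; exists q.
have g0 : g != 0 by rewrite -size_poly_gt0 ltnW.
have q0 : q != 0 by apply: contraNneq g0 => q0; rewrite -dvd0p -q0.
have qltg : (size q < size g)%N.
  rewrite ltn_neqAle dvdp_leq // andbT; apply: contra qng => /eqP e.
  by rewrite -dvdp_size_eqp // e.
have [||r ri rq] := IH q.
- exact: leq_trans gn.
- by rewrite ltn_neqAle eq_sym q1 size_poly_gt0.
by exists r => //; exact: dvdp_trans qg.
Qed.

Section Center.
Variables (k : fieldType) (Q : falgType k).
Hypothesis perfect_k : perfect_field k.
Hypothesis reduced : forall z : Q, central z -> z * z = 0 -> z = 0.
Implicit Types (z : Q) (f : {poly k}) (s : seq (Q * Q)).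

Lemma central_subspace : is_subspace (@central k Q).
Proof.
split=> [a|c u v cu cv a]; first by rewrite mulr0 mul0r.
by rewrite mulrDr mulrDl -scalerAr -scalerAl cu cv.
Qed.

Lemma central1 : central (1 : Q).
Proof. by move=> a; rewrite mulr1 mul1r. Qed.

Lemma centralM (x y : Q) : central x -> central y -> central (x * y).
Proof. by move=> cx cy a; rewrite mulrA cx -mulrA cy mulrA. Qed.

Lemma centralZ c z : central z -> central (c *: z).
Proof. exact: (@subspaceZ k Q (@central k Q) _ _ central_subspace). Qed.

Lemma centralX z n : central z -> central (z ^+ n).
Proof.
by move=> cz; elim: n => [|n IH]; [exact: central1 | rewrite exprS; exact: centralM].
Qed.

Lemma horner_algZX z (c : k) n : horner_alg z (c *: 'X^n) = c *: z ^+ n.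
Proof. by rewrite -mul_polyC rmorphM /= horner_algC rmorphXn /= horner_algX mulr_algl. Qed.

Lemma horner_alg_sum z f : horner_alg z f = \sum_(i < size f) f`_i *: z ^+ i.
Proof.
rewrite -{1}[f]coefK poly_def rmorph_sum /=; apply: eq_bigr => i _.
exact: horner_algZX.
Qed.

Lemma horner_alg_deriv z f :
  horner_alg z f^`() = \sum_(i < size f) f`_i *: (z ^+ i.-1 *+ i).
Proof.
rewrite -{1}[f]coefK poly_def linear_sum rmorph_sum /=; apply: eq_bigr => i _.
by rewrite derivZ derivXn -scalerMnr rmorphMn /= horner_algZX scalerMnr.
Qed.

Lemma central_horner z f : central z -> central (horner_alg z f).
Proof.
move=> cz; rewrite horner_alg_sum; apply: (subspace_sum (S := @central k Q)) => [|i].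
  exact: central_subspace.
by apply: centralZ; exact: centralX.
Qed.

Lemma exists_annihilator z : exists2 f, f != 0 & horner_alg z f = 0.
Proof.
set n := (\dim {:Q}).+1; pose X := [tuple z ^+ i | i < n].
have XE (i : 'I_n) : X`_i = z ^+ i by rewrite -tnth_nth tnth_mktuple.
have : ~~ free X.
  apply/negP => fX; have := dimvS (subvf <<X>>%VS).
  by move/eqP: fX => ->; rewrite size_tuple ltnn.
move/freeP => nX; have [c [cX [i ci]]] : exists c : 'I_n -> k,
    \sum_i c i *: X`_i = 0 /\ exists i, c i <> 0.
  apply: contrapT => nc; apply: nX => c cX i; apply: contrapT => ci.
  by apply: nc; exists c; split=> //; exists i.
exists (\poly_(i < n) c (inord i)).
  by apply/eqP => /polyP/(_ i); rewrite coef_poly ltn_ord inord_val coef0.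
rewrite -[RHS]cX poly_def rmorph_sum /=; apply: eq_bigr => j _.
by rewrite horner_algZX inord_val XE.
Qed.

(** For an annihilating polynomial f of minimal degree, an irreducible common
    factor q of f and f' would, being separable, divide f twice; then the square
    of f / q annihilates z, hence so does f / q because the centre is reduced. *)
Lemma separable_annihilator z : central z ->
  exists2 f, separable_poly f & horner_alg z f = 0.
Proof.
move=> cz; pose P n := `[< exists f, [/\ f != 0, horner_alg z f = 0 & size f = n] >].
have exP : exists n, P n.
  by have [f f0 fz] := exists_annihilator z; exists (size f); apply/asboolP; exists f.
have [n /asboolP[f [f0 fz fn]] nmin] := ex_minnP exP.
exists f => //; apply: contrapT => /negP nsep.
have [|q qi qg] := @exists_irreducible_factor k (gcdp f f^`()).
  rewrite ltn_neqAle eq_sym size_poly_gt0 gcdp_eq0 (negPf f0) andbT.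
  by move: nsep; rewrite unlock.
have := qg; rewrite dvdp_gcd => /andP[/dvdpP[h fh]].
have qsep := perfect_k qi; have q1 := qi.1.
rewrite fh derivM dvdp_addr ?dvdp_mulIr //.
move=> qh'; have /dvdpP[h' hh'] : q %| h.
  by move: qsep qh'; rewrite unlock => qsep; rewrite Gauss_dvdpl.
have hz : horner_alg z h = 0.
  apply: reduced; first exact: central_horner.
  have -> : horner_alg z h * horner_alg z h = horner_alg z (h' * f).
    by rewrite -rmorphM fh {1}hh' -mulrA [q * h]mulrC.
  by rewrite rmorphM /= fz mulr0.
have h0 : h != 0 by apply: contraNneq f0 => h0; rewrite fh h0 mul0r.
have q0 : q != 0 by rewrite -size_poly_gt0 ltnW.
have : (size h < n)%N.
  rewrite -fn fh size_mul // -subn1 -addnBA ?(ltnW q1) //.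
  by rewrite -[X in (X < _)%N]addn0 ltn_add2l subn_gt0.
by rewrite ltnNge nmin //; apply/asboolP; exists h.
Qed.

Definition central_tens s : Prop :=
  (forall p, p \in s -> central p.1 /\ central p.2) /\ \sum_(p <- s) p.1 * p.2 = 1.

(** The identity (z (x) 1) s = (1 (x) z) s, where 1 (x) z multiplies the second
    factors on the right. *)
Definition commutes_with (s : seq (Q * Q)) (z : Q) : Prop :=
  forall (V : lmodType k) (b : Q -> Q -> V), bilin b ->
    tens_eval s (fun x y => b (z * x) y) = tens_eval s (fun x y => b x (y * z)).

(** For f(z) = 0 with f separable, (f(X) - f(Y)) / (X - Y) evaluated at
    X = z (x) 1 and Y = 1 (x) z is killed by X - Y, and multiplication sends it
    to f'(z), which is invertible in k[z]. *)
Lemma exists_tens_commuting_with z : central z ->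
  exists2 s, central_tens s & commutes_with s z.
Proof.
move=> cz; have [f fsep fz] := separable_annihilator cz.
have [w cw wf'] : exists2 w, central w & w * horner_alg z f^`() = 1.
  move: fsep; rewrite unlock => /Bezout_eq1_coprimepP[[u v] /= uv].
  exists (horner_alg z v); first exact: central_horner.
  by rewrite -rmorphM -[RHS](rmorph1 (horner_alg z)) -uv rmorphD !rmorphM /= fz mulr0 add0r.
pose s := [seq (f`_i *: (w * z ^+ a), z ^+ (i.-1 - a)) | i <- iota 0 (size f), a <- iota 0 i].
have sE (V : lmodType k) (b : Q -> Q -> V) : tens_eval s b = \sum_(i < size f)
    \sum_(0 <= a < i) b (f`_i *: (w * z ^+ a)) (z ^+ (i.-1 - a)).
  rewrite /tens_eval big_allpairs_dep /= -{1}[size f]subn0 -/(index_iota 0 _) big_mkord.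
  by apply: eq_bigr => i _; rewrite /index_iota subn0.
exists s; [split|].
- move=> p /allpairsPdep[i [a [_ _ ->]]] /=; split; last exact: centralX.
  by apply: centralZ; apply: centralM; last exact: centralX.
- have := sE Q (fun x y => x * y); rewrite /tens_eval => ->.
  rewrite -wf' horner_alg_deriv mulr_sumr; apply: eq_bigr => i _.
  rewrite (eq_big_nat _ _ (F2 := fun=> f`_i *: (w * z ^+ i.-1))) => [|a /andP[_ ai]].
    by rewrite sumr_const_nat subn0 scalerMnr -mulrnAr scalerAr.
  rewrite -scalerAl -mulrA -exprD subnKC //.
  by rewrite -ltnS prednK // (leq_ltn_trans _ ai).
move=> V b bP; rewrite !sE.
(* the terms of degree i telescope to X^i - Y^i *)
pose t i := b (f`_i *: (w * z ^+ i)) 1 - b (f`_i *: w) (z ^+ i).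
apply/eqP; rewrite -subr_eq0 -sumrB (eq_bigr (fun i : 'I__ => t i)) => [|i _].
  apply/eqP; rewrite /t sumrB -bilin_suml //.
  under [X in _ - X]eq_bigr => i _ do rewrite bilinZl // -bilinZr //.
  rewrite -bilin_sumr // -horner_alg_sum fz bilin0r // subr0.
  under eq_bigr => i _ do rewrite scalerAr.
  by rewrite -mulr_sumr -horner_alg_sum fz mulr0 bilin0l.
pose g a := b (f`_i *: (w * z ^+ a)) (z ^+ (i - a)).
rewrite -sumrB (eq_big_nat _ _ (F2 := fun a => g a.+1 - g a)) => [|a /andP[_ ai]].
  by rewrite telescope_sumr // /g subnn subn0 expr0 mulr1.
have ia : (i - a = (i.-1 - a).+1)%N by case: (nat_of_ord i) ai => // j aj; rewrite subSn.
by rewrite /g -scalerAr -cz -mulrA -exprSr -exprSr subnS ia.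
Qed.

Lemma commutes_with_subspace s : is_subspace (commutes_with s).
Proof.
split=> [V b bP|c u v su sv V b bP].
  by rewrite /tens_eval !big1 // => p _; rewrite ?mulr0 ?mul0r ?(bilin0l bP) ?(bilin0r bP).
have -> : tens_eval s (fun x y => b ((c *: u + v) * x) y) =
    c *: tens_eval s (fun x y => b (u * x) y) + tens_eval s (fun x y => b (v * x) y).
  rewrite /tens_eval scaler_sumr -big_split; apply: eq_bigr => p _ /=.
  by rewrite mulrDl -scalerAl (bilinDl bP) (bilinZl bP).
rewrite su // sv // /tens_eval scaler_sumr -big_split; apply: eq_bigr => p _ /=.
by rewrite mulrDr -scalerAr (bilinDr bP) (bilinZr bP).
Qed.

Definition tens_mul s t : seq (Q * Q) := [seq (p.1 * q.1, p.2 * q.2) | p <- s, q <- t].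

Lemma tens_mulE s t (V : lmodType k) (b : Q -> Q -> V) :
  tens_eval (tens_mul s t) b =
  \sum_(p <- s) \sum_(q <- t) b (p.1 * q.1) (p.2 * q.2).
Proof. by rewrite /tens_eval /tens_mul big_allpairs_dep. Qed.

Lemma central_tens_mul s t : central_tens s -> central_tens t -> central_tens (tens_mul s t).
Proof.
move=> [cs s1] [ct t1]; split=> [_ /allpairsP[[p q] /= [/cs[p1 p2] /ct[q1 q2] ->]]|].
  by split; exact: centralM.
have := tens_mulE s t (fun x y => x * y); rewrite /tens_eval => ->.
transitivity (\sum_(p <- s) p.1 * p.2 * \sum_(q <- t) q.1 * q.2); last first.
  by rewrite t1 -[RHS]s1; apply: eq_bigr => p _; rewrite mulr1.
rewrite big_seq [RHS]big_seq; apply: eq_bigr => p /cs[_ cp2]; rewrite mulr_sumr.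
by apply: eq_bigr => q _; rewrite !mulrA -[p.1 * q.1 * _]mulrA cp2 !mulrA.
Qed.

Lemma commutes_with_mul s t z : central_tens s -> central z ->
  commutes_with s z \/ commutes_with t z -> commutes_with (tens_mul s t) z.
Proof.
move=> [cs _] cz com V b bP; rewrite !tens_mulE; case: com => [sz|tz].
  rewrite exchange_big [RHS]exchange_big; apply: eq_bigr => q _.
  have := sz V (fun x y => b (x * q.1) (y * q.2)); rewrite /tens_eval => sz'.
  transitivity (\sum_(p <- s) b (z * p.1 * q.1) (p.2 * q.2)).
    by apply: eq_bigr => p _; rewrite mulrA.
  rewrite sz'; last by apply: bilin_comp => //; exact: mulr_linear.
  by apply: eq_bigr => p _; rewrite -[p.2 * z * _]mulrA -cz mulrA.
rewrite big_seq [RHS]big_seq; apply: eq_bigr => p /cs[cp1 cp2].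
have := tz V (fun x y => b (p.1 * x) (p.2 * y)); rewrite /tens_eval => tz'.
transitivity (\sum_(q <- t) b (p.1 * (z * q.1)) (p.2 * q.2)).
  by apply: eq_bigr => q _; rewrite !mulrA cz.
rewrite tz'; last by apply: bilin_comp => //; exact: mull_linear.
by apply: eq_bigr => q _; rewrite mulrA.
Qed.

(** Take a tensor commuting with as large a part of the centre as possible;
    multiplying it by one that commutes with a further z would enlarge that part. *)
Lemma center_separable : exists2 s, central_tens s & forall z, central z -> commutes_with s z.
Proof.
pose P (U : {vspace Q}) := (forall z, z \in U -> central z) /\
  exists2 s, central_tens s & forall z, z \in U -> commutes_with s z.
have [|U [cU [s cs sU]] Umax] := @vspace_max k Q P.
  exists 0%VS; split=> [z /[!memv0] /eqP ->|]; first exact: central_subspace.1.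
  have [s cs _] := exists_tens_commuting_with central1.
  by exists s => // z /[!memv0] /eqP ->; exact: (commutes_with_subspace s).1.
exists s => // z cz; have [t ct tz] := exists_tens_commuting_with cz.
suff : z \in U by exact: sU.
rewrite -(Umax (U + <[z]>)%VS) ?addvSl //; first by rewrite memvE addvSr.
split=> [_ /memv_addP[u /cU cu [_ /vlineP[c ->] ->]]|].
  by rewrite addrC; apply: central_subspace.2.
exists (tens_mul s t); first exact: central_tens_mul.
move=> _ /memv_addP[u Uu [_ /vlineP[c ->] ->]]; rewrite addrC.
apply: (commutes_with_subspace _).2; apply: commutes_with_mul => //.
- by right.
- exact: cU.
- by left; exact: sU.
Qed.

End Center.

Section Separable.
Variables (k : fieldType) (Q : falgType k).
Hypothesis perfect_k : perfect_field k.
Hypothesis Qunity : ideals_have_unity Q.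

(** A separability idempotent: it gives a bimodule section of the
    multiplication Q (x) Q -> Q. *)
Definition separability_idempotent (s : seq (Q * Q)) : Prop :=
  \sum_(p <- s) p.1 * p.2 = 1 /\ forall a, commutes_with s a.

(** Jacobson density for Q as a bimodule: with b a basis, the sub-bimodule of a
    power of Q generated by b is stable under the linear maps that commute with
    the centre, because its projector has central entries. *)
Lemma central_linear_is_two_sided_mul (f : {linear Q -> Q}) :
  (forall z q, central z -> f (q * z) = f q * z) ->
  exists s : seq (Q * Q), forall q, f q = \sum_(p <- s) p.1 * q * p.2.
Proof.
move=> fz; pose d := \dim {:Q}; pose e (i : 'I_d) := (vbasis {:Q})`_i.
have [|N NE] := @subspace_vspace k {ffun 'I_d -> Q}
  (fun v => exists s : seq (Q * Q), forall i, v i = \sum_(p <- s) p.1 * e i * p.2).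
  split; first by exists [::] => i; rewrite big_nil ffunE.
  move=> c u v [s sP] [t tP]; exists ([seq (c *: p.1, p.2) | p <- s] ++ t) => i.
  rewrite big_cat big_map /= !ffunE sP tP scaler_sumr; congr (_ + _).
  by apply: eq_bigr => p _; rewrite -!scalerAl.
have bN : bimodule_vs N.
  move=> a v /NE[s sP]; split; apply/NE.
    exists [seq (a * p.1, p.2) | p <- s] => i.
    rewrite ffunE sP big_map mulr_sumr.
    by apply: eq_bigr => p _; rewrite !mulrA.
  exists [seq (p.1, p.2 * a) | p <- s] => i.
  rewrite ffunE sP big_map mulr_suml.
  by apply: eq_bigr => p _; rewrite !mulrA.
have [z [zN cz zP]] := bimodule_projector Qunity bN.
have eN : [ffun i => e i] \in N.
  by apply/NE; exists [:: (1, 1)] => i; rewrite big_seq1 ffunE mulr1 mul1r.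
have : [ffun i => f (e i)] \in N.
  have -> : [ffun i => f (e i)] = \sum_s lact (f (e s)) (z s).
    apply/ffunP => r; rewrite sum_ffunE ffunE; have := zP _ eN r; rewrite ffunE => ->.
    by rewrite linear_sum; apply: eq_bigr => s _ /=; rewrite !ffunE fz.
  by apply: memv_suml => s _; case: (bN (f (e s)) _ (zN s)).
move=> /NE[s sP]; exists s => q.
have [c ->] : exists c : 'I_d -> k, q = \sum_i c i *: e i.
  by exists (fun i => coord (vbasis {:Q}) i q); exact: coord_vbasis (memvf q).
rewrite linear_sum.
transitivity (\sum_(p <- s) \sum_i c i *: (p.1 * e i * p.2)).
  rewrite exchange_big; apply: eq_bigr => i _ /=.
  by have := sP i; rewrite ffunE linearZ /= => ->; rewrite scaler_sumr.
apply: eq_bigr => p _; rewrite mulr_sumr mulr_suml; apply: eq_bigr => i _.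
by rewrite -scalerAr -scalerAl.
Qed.

(** The tensor product of Q with itself over the centre embeds in the linear
    maps of Q. With x the left factors of s, the tuples v such that
    sum x_r q v_r = 0 for all q form a bimodule N, which contains the tuple y of
    the right factors. So y_r = sum_i z_ir y_i with central z_ir such that the
    tuple (z_ir)_r is in N; moving z_ir to the left factors produces
    sum_r x_r z_ir = 0. *)
Lemma two_sided_mul_eq0 (s : seq (Q * Q)) :
  (forall q, \sum_(p <- s) p.1 * q * p.2 = 0) ->
  forall (V : lmodType k) (b : Q -> Q -> V), bilin b ->
    (forall z x y, central z -> b (x * z) y = b x (z * y)) -> tens_eval s b = 0.
Proof.
move=> s0 V b bP bz; pose n := size s.
pose X (i : 'I_n) := (tnth (in_tuple s) i).1; pose Y (i : 'I_n) := (tnth (in_tuple s) i).2.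
have sumE (W : zmodType) (F : Q * Q -> W) : \sum_(p <- s) F p = \sum_i F (X i, Y i).
  by rewrite big_tnth; apply: eq_bigr => i _; rewrite -surjective_pairing.
have [|N NE] := @subspace_vspace k {ffun 'I_n -> Q}
  (fun v => forall q, \sum_i X i * q * v i = 0).
  split=> [q|c u v u0 v0 q]; first by rewrite big1 // => i _; rewrite ffunE mulr0.
  transitivity (c *: (\sum_i X i * q * u i) + \sum_i X i * q * v i).
    rewrite scaler_sumr -big_split; apply: eq_bigr => i _ /=.
    by rewrite !ffunE mulrDr scalerAr.
  by rewrite u0 v0 scaler0 addr0.
have bN : bimodule_vs N.
  move=> a v /NE v0; split; apply/NE => q.
    rewrite -[RHS](v0 (q * a)); apply: eq_bigr => i _.
    by rewrite ffunE !mulrA.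
  transitivity ((\sum_i X i * q * v i) * a); last by rewrite v0 mul0r.
  by rewrite mulr_suml; apply: eq_bigr => i _; rewrite ffunE mulrA.
have [z [zN cz zP]] := bimodule_projector Qunity bN.
have YN : [ffun i => Y i] \in N.
  by apply/NE => q; rewrite -[RHS](s0 q) sumE; apply: eq_bigr => i _; rewrite ffunE.
rewrite /tens_eval sumE /=.
have YE r : Y r = \sum_i z i r * Y i.
  have := zP _ YN r; rewrite ffunE => ->.
  by apply: eq_bigr => i _; rewrite ffunE cz.
under eq_bigr => r _ do rewrite YE (bilin_sumr bP).
rewrite exchange_big big1 // => i _ /=.
under eq_bigr => r _ do rewrite -bz //.
rewrite -(bilin_suml bP); have /NE/(_ 1) := zN i.
by under eq_bigr => r _ do rewrite mulr1; move=> ->; rewrite (bilin0l bP).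
Qed.

(** With t the separability idempotent of the centre, q |-> sum t_1 g(t_2 q) for
    a linear projection g onto the centre is a centre-linear projection, hence
    of the form q |-> sum x q y. Inserting t in the middle of the tensors x (x) y
    gives a separability idempotent of Q. *)
Theorem exists_separability_idempotent :
  exists s : seq (Q * Q), separability_idempotent s.
Proof.
have [t [ct t1] tz] := center_separable perfect_k (central_reduced Qunity).
have [Z ZE] := subspace_vspace (@central_subspace k Q).
pose g := projv Z; have gZ z : central z -> g z = z by move=> /ZE Zz; rewrite projv_id.
pose f0 q := \sum_(p <- t) p.1 * g (p.2 * q).
have f_lin : linear f0.
  move=> c u v; rewrite /f0 scaler_sumr -big_split; apply: eq_bigr => p _ /=.
  by rewrite mulrDr -scalerAr linearP mulrDr -scalerAr.
pose f : {linear Q -> Q} := HB.pack f0 (GRing.isLinear.Build _ _ _ _ _ f_lin).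
have cf q : central (f q).
  rewrite /f /= /f0 big_seq; apply: (big_ind (@central k Q)) => [|u v|p /ct[c1 c2]].
  - exact: (@central_subspace k Q).1.
  - by apply: (@subspaceD k Q (@central k Q)); exact: central_subspace.
  - by apply: centralM => //; apply/ZE/memv_proj.
have f1 : f 1 = 1.
  rewrite -[RHS]t1 /f /= /f0 big_seq [RHS]big_seq; apply: eq_bigr => p /ct[_ c2].
  by rewrite mulr1 gZ.
have [|s0 s0E] := @central_linear_is_two_sided_mul f.
  move=> z q cz; have := tz z cz Q (fun x y => x * g (y * q)).
  rewrite /tens_eval /f /= /f0 => h.
  rewrite [RHS]cz mulr_sumr; under [RHS]eq_bigr => p _ do rewrite mulrA.
  rewrite h; last first.
    by split=> [x|y] c u v;
       rewrite ?mulrDl ?linearD ?mulrDr -?scalerAl ?linearZ -?scalerAr.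
  by apply: eq_bigr => p _; rewrite cz mulrA.
exists [seq (p.1 * q.1, q.2 * p.2) | p <- s0, q <- t].
have sE (V : lmodType k) (b : Q -> Q -> V) :
    tens_eval [seq (p.1 * q.1, q.2 * p.2) | p <- s0, q <- t] b =
    \sum_(p <- s0) \sum_(q <- t) b (p.1 * q.1) (q.2 * p.2).
  by rewrite /tens_eval big_allpairs_dep.
split.
  have := sE Q (fun x y => x * y); rewrite /tens_eval => ->.
  rewrite -f1 s0E; apply: eq_bigr => p _; rewrite -t1 mulr_sumr mulr_suml.
  by apply: eq_bigr => q _; rewrite !mulrA.
move=> a V b bP; rewrite !sE.
(* b' is b precomposed with the insertion of t, which makes it balanced over the
   centre; s1 is the tensor of q |-> a * f q - f q * a, which is 0 *)
pose b' x y := tens_eval t (fun u v => b (x * u) (v * y)).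
have b'P : bilin b'.
  split=> [x|y] c u v; rewrite /b' /tens_eval scaler_sumr -big_split.
    by apply: eq_bigr => p _ /=; rewrite mulrDr -scalerAr (bilinDr bP) (bilinZr bP).
  by apply: eq_bigr => p _ /=; rewrite mulrDl -scalerAl (bilinDl bP) (bilinZl bP).
pose s1 := [seq (a * p.1, p.2) | p <- s0] ++ [seq (- p.1, p.2 * a) | p <- s0].
have : tens_eval s1 b' = 0.
  apply: two_sided_mul_eq0 => // [q|z x y cz].
    rewrite big_cat !big_map /=.
    under eq_bigr => p _ do rewrite -!mulrA [p.1 * _]mulrA.
    under [X in _ + X]eq_bigr => p _ do rewrite !mulNr mulrA.
    by rewrite sumrN -mulr_sumr -mulr_suml -s0E cf subrr.
  have := tz z cz V (fun u v => b (x * u) (v * y)); rewrite /b' /tens_eval => tz'.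
  transitivity (\sum_(p <- t) b (x * (z * p.1)) (p.2 * y)).
    by apply: eq_bigr => p _; rewrite mulrA.
  rewrite tz'; first by apply: eq_bigr => p _; rewrite mulrA.
  by apply: bilin_comp => //; [exact: mull_linear | exact: mulr_linear].
rewrite /tens_eval big_cat !big_map /=.
under [X in _ + X]eq_bigr => p _ do rewrite (bilinNl b'P).
rewrite sumrN => /subr0_eq; rewrite /b' /tens_eval => e.
transitivity (\sum_(p <- s0) \sum_(q <- t) b (a * p.1 * q.1) (q.2 * p.2)).
  by apply: eq_bigr => p _; apply: eq_bigr => q _; rewrite mulrA.
by rewrite e; apply: eq_bigr => p _; apply: eq_bigr => q _; rewrite mulrA.
Qed.
End Separable.

(** * Lifting a homomorphism along a nilpotent kernel *)

Section Lifting.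
Variables (k : fieldType) (Q L : algType k) (pi : {linear L -> Q}).
Hypotheses (piM : forall x y, pi (x * y) = pi x * pi y) (pi1 : pi 1 = 1).

(** [P] plays the role of the powers of the kernel, with P n the power n + 1. *)
Variables (P : nat -> set L) (t : nat).
Hypotheses (P_sub : forall n, is_subspace (P n))
  (P_ideal : forall n a x, P n x -> P n (a * x) /\ P n (x * a))
  (P_ker : forall n x, P n x -> pi x = 0) (ker_P : forall x, pi x = 0 -> P 0 x)
  (P_mul : forall n x y, P 0 x -> P n y -> P n.+1 (x * y))
  (P_nil : forall x, P t x -> x = 0).

Variable s : seq (Q * Q).
Hypotheses (s1 : \sum_(p <- s) p.1 * p.2 = 1)
  (sP : forall a (V : lmodType k) (b : Q -> Q -> V), bilin b ->
    tens_eval s (fun x y => b (a * x) y) = tens_eval s (fun x y => b x (y * a))).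

Let defect (f : {linear Q -> L}) a b := f a * f b - f (a * b).

(** The defect of a section is a 2-cocycle; contracting it with the separability
    idempotent gives a cochain whose coboundary it is modulo the next power. *)
Lemma lift_step (f : {linear Q -> L}) n : (forall q, pi (f q) = q) ->
  (forall a b, P n (defect f a b)) ->
  exists2 g : {linear Q -> L}, forall q, pi (g q) = q &
    forall a b, P n.+1 (defect g a b).
Proof.
move=> pif fP; have P0 m x : P m x -> P 0 x by move=> /P_ker /ker_P.
pose h a := \sum_(p <- s) f p.1 * defect f p.2 a.
have dl c u v b : defect f (c *: u + v) b = c *: defect f u b + defect f v b.
  by rewrite /defect mulrDl -scalerAl !(linearP f) mulrDl -scalerAl opprD addrACA scalerBr.
have dr c u v a : defect f a (c *: u + v) = c *: defect f a u + defect f a v.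
  by rewrite /defect mulrDr -scalerAr !(linearP f) mulrDr -scalerAr opprD addrACA scalerBr.
have Ph a : P n (h a).
  by apply: subspace_sum => // p; case: (P_ideal (f p.1) (fP p.2 a)).
pose g0 a := f a - h a.
have g_lin : linear g0.
  move=> c u v; rewrite /g0 linearP scalerBr addrACA -opprD; congr (_ - _).
  rewrite /h scaler_sumr -big_split; apply: eq_bigr => p _ /=.
  by rewrite dr mulrDr scalerAr.
pose g : {linear Q -> L} := HB.pack g0 (GRing.isLinear.Build _ _ _ _ _ g_lin).
exists g => [q|a b]; first by rewrite /g /= /g0 linearB pif (P_ker (Ph q)) subr0.
pose e := \sum_(p <- s) f p.1 * f p.2.
have hb : f a * h b = e * defect f a b + h (a * b) - h a * f b
    + \sum_(p <- s) defect f a p.1 * defect f p.2 b.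
  transitivity (\sum_(p <- s) f (a * p.1) * defect f p.2 b
    + \sum_(p <- s) defect f a p.1 * defect f p.2 b).
    rewrite -big_split mulr_sumr; apply: eq_bigr => p _ /=.
    by rewrite -mulrDl addrC subrK mulrA.
  congr (_ + _); have := @sP a L (fun x y => f x * defect f y b).
  rewrite /tens_eval => ->; last first.
    split=> [x|y] c u v; first by rewrite dl mulrDr scalerAr.
    by rewrite linearP mulrDl scalerAl.
  rewrite /e /h !mulr_suml -sumrN -!big_split; apply: eq_bigr => p _ /=.
  rewrite -!mulrA -mulrDr -mulrBr; congr (_ * _); rewrite /defect mulrBr mulrBl !mulrA.
  by rewrite addrA subrK opprB [RHS]addrC addrA subrK.
have -> : defect g a b = (1 - e) * defect f a b
    - \sum_(p <- s) defect f a p.1 * defect f p.2 b + h a * h b.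
  have -> : defect g a b = defect f a b - f a * h b - h a * f b + h (a * b) + h a * h b.
    rewrite /defect /g /= /g0 mulrBl !mulrBr !opprB.
    by rewrite (AC (2*2*2) (1*6*2*4*5*3))%AC.
  rewrite hb mulrBl mul1r; congr (_ + _); rewrite !opprD !opprK !addrA.
  by rewrite (ACl (1*2*5*(7*3)*(4*6)))%AC /= !subrr !addr0.
have P0f a' b' : P 0 (defect f a' b') by exact: P0 (fP a' b').
apply: subspaceD => //; last by apply: P_mul; [exact: P0 (Ph a) | exact: Ph].
apply: subspaceB => //; last first.
  by apply: subspace_sum => // p; apply: P_mul; [exact: P0f | exact: fP].
apply: P_mul; last exact: fP.
apply: ker_P; rewrite linearB /= pi1 /e linear_sum.
by under eq_bigr => p _ do rewrite /= piM !pif; rewrite s1 subrr.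
Qed.

(** A multiplicative section preserves 1 since 1 - f 1 is an idempotent of the
    nilpotent kernel. *)
Lemma lift_section (f0 : {linear Q -> L}) : (forall q, pi (f0 q) = q) ->
  exists f : {linear Q -> L}, [/\ forall q, pi (f q) = q,
    forall a b, f (a * b) = f a * f b & f 1 = 1].
Proof.
move=> pif0; have [f pif fP] : exists2 f : {linear Q -> L}, forall q, pi (f q) = q &
    forall a b, P t (defect f a b).
  move: (t) => m; elim: m => [|n [f pif fP]]; last exact: lift_step pif fP.
  by exists f0 => // a b; apply: ker_P; rewrite /defect linearB /= piM !pif0 subrr.
have fM a b : f (a * b) = f a * f b by apply/esym/eqP; rewrite -subr_eq0; apply/eqP/P_nil/fP.
exists f; split=> //; pose e := 1 - f 1.
have ee : e * e = e by rewrite {2}/e mulrBr mulr1 {2}/e mulrBl mul1r -fM mulr1 subrr subr0.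
have Pe n : P n e.
  have P0e : P 0 e by apply: ker_P; rewrite linearB /= pi1 pif subrr.
  by elim: n => // n IH; rewrite -ee; apply: P_mul.
by apply/esym/eqP; rewrite -subr_eq0 -/e; apply/eqP/P_nil.
Qed.

End Lifting.

(** * The Jacobson radical of a finite dimensional algebra *)

Section UnitalAlias.
Variables (k : fieldType) (A : nuAlgType k).

(** The falgType structure of a finite dimensional algebra with non-zero unity
    depends on proofs, which the alias carries as phantom arguments. *)
Definition unital n of Vector.axiom n A := fun (u : A) of u != 0 & is_unity u => (A : Type).

Variables (n : nat) (ax : Vector.axiom n A) (u : A) (u0 : u != 0) (uP : is_unity u).
Local Notation U := (unital ax u0 uP).

HB.instance Definition _ := GRing.Lmodule.on U.
Lemma unital_1l : left_id (u : U) (@numul k A : U -> U -> U).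
Proof. by move=> x; case: (uP x). Qed.
Lemma unital_1r : right_id (u : U) (@numul k A : U -> U -> U).
Proof. by move=> x; case: (uP x). Qed.
HB.instance Definition _ := GRing.Zmodule_isNzRing.Build U
  (@numulA k A : associative (@numul k A : U -> U -> U)) unital_1l unital_1r
  (@numulDl k A) (@numulDr k A) u0.
HB.instance Definition _ := GRing.Lmodule_isLalgebra.Build k U
  (fun c (x y : U) => esym (@numulZl k A c x y)).
HB.instance Definition _ := GRing.Lalgebra_isAlgebra.Build k U
  (fun c (x y : U) => esym (@numulZr k A c x y)).
HB.instance Definition _ := Lmodule_hasFinDim.Build k U ax.
HB.instance Definition _ := Algebra_isFalgebra.Build k U.

Lemma modular_maximal_vs (M : set A) : modular_maximal_left_ideal M ->
  exists M' : {vspace U}, [/\ forall x : U, x \in M' <-> M x, left_ideal_vs M' &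
    forall N : {vspace U}, left_ideal_vs N -> (M' <= N)%VS -> N = M' \/ N = fullv].
Proof.
move=> [[sM lM] _ _ Mmax]; have [M' M'E] := @subspace_vspace k U M sM.
exists M'; split=> // [a x /M'E Mx|N lN MN]; first by apply/M'E/lM.
have [|x /M'E Mx|NM|NT] := Mmax [set x | (x : U) \in N].
- split=> [|a x Nx]; last exact: lN.
  by split=> [|c v w Nv Nw] /=; rewrite ?mem0v // memvD ?memvZ.
- exact: (subvP MN).
- left; apply/vspaceP => x; apply/idP/idP => [Nx|/M'E Mx].
    by apply/M'E; rewrite -NM.
  by move: Mx; rewrite -NM.
- right; apply/vspaceP => x; rewrite memvf.
  by have : [set x | (x : U) \in N] x by rewrite NT.
Qed.

Lemma maximal_left_ideal_of_jacobson0 : jacobson_set (A := A) = [set 0] ->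
  forall x : U, x != 0 -> exists M : {vspace U}, [/\ left_ideal_vs M, x \notin M &
    forall N, left_ideal_vs N -> (M <= N)%VS -> N = M \/ N = fullv].
Proof.
move=> J0 x x0; have [M [Mmax Mx]] : exists M : set A, modular_maximal_left_ideal M /\ ~ M x.
  apply: contrapT => nM; case/eqP: x0; suff : [set 0 : A] x by [].
  rewrite -J0 => M Mmax; apply: contrapT => Mx; apply: nM; by exists M.
have [M' [M'E lM' M'max]] := modular_maximal_vs Mmax.
by exists M'; split=> //; apply/negP => /M'E.
Qed.

(** Nakayama: for a maximal proper left subideal W of a left ideal V and v in V
    outside W, the annihilator of v modulo W is a maximal left ideal, so it
    contains the radical; hence the radical maps V into W. *)
Lemma jacobson_mul_proper (V : {vspace U}) : left_ideal_vs V -> V <> 0%VS ->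
  exists W : {vspace U}, [/\ left_ideal_vs W, (W <= V)%VS, W <> V &
    forall r v : U, jacobson_set (A := A) r -> v \in V -> r * v \in W].
Proof.
move=> lV V0; pose P (W : {vspace U}) := [/\ left_ideal_vs W, (W <= V)%VS & W <> V].
have [|W [lW WV WnV] Wmax] := @vspace_max k U P.
  exists 0%VS; split; [| exact: sub0v | exact/nesym].
  by move=> a x; rewrite !memv0 => /eqP ->; rewrite mulr0.
exists W; split=> // r v Jr Vv; have [Wv|Wv] := boolP (v \in W); first exact: lW.
apply: (Jr (fun a : A => (a : U) * v \in W)); split.
- split=> [|a b Wb]; first split=> [|c a b Wa Wb].
  + by rewrite -[(0 : A)]/(0 : U) mul0r mem0v.
  + by have := memvD (memvZ c Wa) Wb; rewrite scalerAl -mulrDl.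
  + by rewrite -[(_ ** _)]/((a : U) * b) -mulrA; apply: lW.
- exists u => x; rewrite -[x ** u]/((x : U) * 1) mulr1 subrr mul0r; exact: mem0v.
- move=> T; have : setT (u : A) by [].
  by rewrite -T -[u]/(1 : U) mul1r; apply/negP.
move=> N [sN lN] WN; have [NW|nNW] := EM (N `<=` (fun a : A => (a : U) * v \in W)).
  by left; apply/seteqP.
right; have [n' Nn' Wn'v] : exists2 n', N n' & (n' : U) * v \notin W.
  apply: contrapT => h; apply: nNW => a Na; apply: contrapT => Wav; apply: h.
  by exists a => //; apply/negP.
have [|W' W'E] := @subspace_vspace k U (fun w => exists x a : U, [/\ x \in W, N a & w = x + a * v]).
  split; first by exists 0, 0; rewrite mem0v mul0r addr0; split=> //; exact: sN.1.
  move=> c _ _ [x [a [Wx Na ->]]] [y [b [Wy Nb ->]]].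
  exists (c *: x + y), (c *: a + b); split; [by rewrite memvD ?memvZ | exact: sN.2 |].
  by rewrite mulrDl scalerDr addrACA -scalerAl.
have WW' : (W <= W')%VS.
  apply/subvP => x Wx; apply/W'E; exists x, 0; split=> //; first exact: sN.1.
  by rewrite mul0r addr0.
have W'V : W' = V.
  apply: contrapT => W'nV; case/negP: Wn'v; rewrite -(Wmax W') //.
    by apply/W'E; exists 0, n'; rewrite mem0v add0r.
  split=> //.
    move=> a _ /W'E[x [b [Wx Nb ->]]]; apply/W'E; exists (a * x), (a * b).
    by split; [exact: lW | exact: lN | rewrite mulrDr mulrA].
  apply/subvP => _ /W'E[x [b [Wx Nb ->]]]; apply: memvD; [exact: (subvP WV) | exact: lV].
have /W'E[x [a [Wx Na ev]]] : v \in W' by rewrite W'V.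
have N1 : N u.
  rewrite -[u](subrK (a : A)); apply: subspaceD => //; apply: WN.
  by rewrite -[u]/(1 : U) mulrBl mul1r {1}ev addrK.
by apply/seteqP; split=> // y _; rewrite -[y](uP y).2; apply: lN.
Qed.

(** By induction on the dimension, some power of the radical kills each left
    ideal; for the whole algebra this kills 1. *)
Lemma jacobson_nilpotent :
  exists t, forall x : A, ideal_pow (jacobson A) t.+1 x -> x = 0.
Proof.
suff [t tP] : exists t, forall x y : U,
    ideal_pow (jacobson A) t.+1 x -> y \in fullv -> x * y = 0.
  by exists t => x Jx; rewrite -(tP x u Jx (memvf _)); case: (uP x).
have : left_ideal_vs {:U} by move=> a x _; exact: memvf.
have [m] := ubnP (\dim {:U}); move: fullv => V.
elim: m V => // m IH V /ltnSE Vm lV; have [->|/eqP V0] := eqVneq V 0%VS.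
  by exists 0 => x y _; rewrite memv0 => /eqP ->; rewrite mulr0.
have [W [lW WV WnV WP]] := jacobson_mul_proper lV V0.
have [|t tP] := IH W _ lW.
  apply: leq_trans Vm; rewrite ltnNge; apply/negP => dWV.
  by apply: WnV; apply/eqP; rewrite eqEdim WV.
exists t.+1 => x y Jx Vy; apply: (Jx (fun x : A => (x : U) * y = 0)).
  split=> [|c v w v0 w0]; first exact: mul0r.
  suff : ((c *: (v : U) + w) * y : U) = 0 by [].
  by rewrite mulrDl -scalerAl v0 w0 scaler0 addr0.
move=> _ [a [r [Ja [Jr ->]]]]; rewrite -[(a ** r)]/((a : U) * r) -mulrA.
by apply: tP => //; apply: WP.
Qed.

End UnitalAlias.

(** * Quotient algebras and the principal theorem *)

Section Quotients.
Variables (k : fieldType) (A : nuAlgType k).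

Definition quot_proj_linear (I : ideal A) : {linear A -> quotalg I} :=
  HB.pack (quot_proj I) (GRing.isLinear.Build _ _ _ _ (quot_proj I)
    (fun c x y => etrans (quot_projD _ _ _) (congr1 (+%R^~ _) (quot_projZ _ _ _)))).

Lemma quot_projM (I : ideal A) x y : quot_proj I (x ** y) = quot_proj I x ** quot_proj I y.
Proof. by apply/esym/quot_mulE. Qed.

Lemma quot_proj0 (I : ideal A) : quot_proj I 0 = 0.
Proof. exact: (linear0 (quot_proj_linear I)). Qed.

Lemma quot_projB (I : ideal A) x y : quot_proj I (x - y) = quot_proj I x - quot_proj I y.
Proof. exact: (linearB (quot_proj_linear I)). Qed.

Lemma quot_proj0P (I : ideal A) x : quot_proj I x = 0 <-> ideal_set I x.
Proof.
rewrite -(quot_proj0 I) -[x in ideal_set _ x]subr0; exact: quot_projP.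
Qed.

Lemma findim_quotalg (I : ideal A) : findim A -> findim (quotalg I).
Proof.
by apply: (@findim_surj k _ _ (quot_proj_linear I)); apply: quot_ind => x; exists x.
Qed.

Lemma is_unity_quot (I : ideal A) u : is_unity u -> is_unity (quot_proj I u).
Proof. by move=> uP; apply: quot_ind => x; rewrite -!quot_projM !(uP x).1 !(uP x).2. Qed.

Variable I : ideal A.

Lemma ideal_pow_is_ideal t : is_ideal (ideal_pow I t).
Proof.
rewrite /ideal_pow; elim: t.-1 => [|m [sX iX]] /=; first exact: idealP.
split=> [|a x]; first exact: span_subspace.
set S := span _; have sS : is_subspace S := @span_subspace _ _ _.
move=> Sx; apply: (Sx (fun x => S (a ** x) /\ S (x ** a))); last first.
  move=> _ [y [z [Xy [Iz ->]]]]; split.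
    by rewrite numulA; apply: sub_span; exists (a ** y), z; split; [case: (iX a y Xy)|].
  rewrite -numulA; apply: sub_span; exists y, (z ** a); split=> //; split=> //.
  by case: ((idealP I).2 a z Iz).
split=> [|c v w [v1 v2] [w1 w2]]; first by rewrite numul0r numulr0; split; exact: sS.1.
by rewrite numulDl numulDr numulZl numulZr; split; exact: sS.2.
Qed.

Lemma ideal_pow_mul t x y : ideal_set I x -> ideal_pow I t.+1 y -> ideal_pow I t.+2 (x ** y).
Proof.
move=> Ix; elim: t y => [|t IH] y Iy; first by apply: sub_span; exists x, y.
have sS := (ideal_pow_is_ideal t.+3).1.
apply: (Iy (fun y => ideal_pow I t.+3 (x ** y))).
  split=> [|c v w v1 w1]; first by rewrite numulr0; exact: sS.1.
  by rewrite numulDr numulZr; exact: sS.2.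
move=> _ [v [w [Xv [Iw ->]]]]; rewrite numulA; apply: sub_span.
by exists (x ** v), w; split; [exact: IH|].
Qed.

Lemma ideal_pow_sub t x : ideal_pow I t x -> ideal_set I x.
Proof.
rewrite /ideal_pow; elim: t.-1 x => [//|m IH] x /=; apply; first exact: (idealP I).1.
by move=> _ [v [w [_ [Iw ->]]]]; case: ((idealP I).2 v w Iw).
Qed.

(** The modular maximal left ideals of the quotient are the images of those of
    the algebra, as all of these contain the radical. *)
Lemma jacobson_quot_jacobson : jacobson_set (A := quotalg (jacobson A)) = [set 0].
Proof.
apply/seteqP; split; last first.
  by move=> _ ->; exact: (@jacobson_is_ideal k (quotalg (jacobson A))).1.1.
elim/quot_ind=> x Jx; apply/quot_proj0P => M [[sM lM] [e eM] MT Mmax].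
have JM y : jacobson_set y -> M y by apply; split=> //; exists e.
pose M' : set (quotalg (jacobson A)) := fun q => exists2 y, M y & q = quot_proj _ y.
have M'E y : M' (quot_proj _ y) <-> M y.
  split=> [[z Mz /quot_projP /JM Myz]|My]; last by exists y.
  by rewrite -[y](subrK z); apply: subspaceD.
apply/M'E; apply: Jx; split.
- split; first split.
  + by exists 0; [exact: sM.1 | rewrite quot_proj0].
  + move=> c _ _ [y My ->] [z Mz ->]; exists (c *: y + z); first exact: sM.2.
    by rewrite quot_projD quot_projZ.
  + by elim/quot_ind=> a _ [y My ->]; exists (a ** y); [exact: lM | rewrite quot_projM].
- exists (quot_proj _ e); elim/quot_ind=> y.
  by rewrite -quot_projM -quot_projB; apply/M'E.
- move=> M'T; apply: MT; apply/seteqP; split=> // y _; apply/M'E.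
  by rewrite M'T.
- move=> N [sN lN] M'N.
  have [||NM|NT] := Mmax (fun y => N (quot_proj _ y)).
  + split; first split.
    * by rewrite quot_proj0; exact: sN.1.
    * by move=> c y z Ny Nz; rewrite quot_projD quot_projZ; exact: sN.2.
    * by move=> a y Ny; rewrite quot_projM; exact: lN.
  + by move=> y /M'E /M'N.
  + left; apply/seteqP; split=> // q; elim/quot_ind: q => y Ny.
    by apply/M'E; rewrite -NM.
  + right; apply/seteqP; split=> // q _; elim/quot_ind: q => y.
    by have : [set: A] y by []; rewrite -NT.
Qed.

End Quotients.

Lemma jacobson_neq_unity (k : fieldType) (A : nuAlgType k) (u : A) :
  findim A -> u != 0 -> is_unity u -> ~ jacobson_set u.
Proof.
move=> [n [ax]] u0 uP Ju; have [t tP] := jacobson_nilpotent ax u0 uP.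
case/eqP: u0; apply: tP; elim: t => [//|t IH].
by rewrite -[u](uP u).1; apply: ideal_pow_mul.
Qed.

(** Wedderburn's principal theorem: the quotient by the radical is semisimple,
    hence separable as k is perfect, and the radical is nilpotent, so that a
    linear section of the projection can be corrected to a multiplicative one. *)
Theorem wedderburn_principal (k : fieldType) (L : nuAlgType k) (u : L) :
  perfect_field k -> findim L -> u != 0 -> is_unity u ->
  exists s : {linear quotalg (jacobson L) -> L},
    [/\ forall q, quot_proj _ (s q) = q, {morph s : x y / x ** y}
      & s (quot_proj _ u) = u].
Proof.
move=> perfect_k fL u0 uP; have [n [ax]] := fL.
pose Q := quotalg (jacobson L); pose pi := quot_proj_linear (jacobson L).
have [m [axQ]] : findim Q by exact: findim_quotalg.
have uQP := is_unity_quot (I := jacobson L) uP.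
have uQ0 : quot_proj (jacobson L) u != 0.
  by apply/eqP => /quot_proj0P; exact: jacobson_neq_unity.
pose L' := unital ax u0 uP; pose Q' := unital axQ uQ0 uQP.
have Qunity : ideals_have_unity Q'.
  apply: ideals_have_unity_of_right; apply: left_ideal_right_unity.
  exact: maximal_left_ideal_of_jacobson0 (jacobson_quot_jacobson L).
have [s [s1 sP]] := exists_separability_idempotent perfect_k Qunity.
have [t tP] := jacobson_nilpotent ax u0 uP.
have [f0 f0P] : exists f : {linear Q' -> L'}, forall q, pi (f q) = q.
  pose p : 'Hom(L', Q') := linfun (pi : {linear L' -> Q'}).
  exists (p^-1)%VF => q; have := @limg_lfunVK k L' Q' p q.
  rewrite lfunE; apply.
  by apply/memv_imgP; exists (repr q); rewrite ?memvf // lfunE /= quot_proj_repr.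
have ideal_powP i := ideal_pow_is_ideal (jacobson L) i.+1.
have [f [fpi fM f1]] := @lift_section k Q' L' pi (@quot_projM k L _) erefl
  (fun i => ideal_pow (jacobson L) i.+1) t (fun i => (ideal_powP i).1)
  (fun i => (ideal_powP i).2)
  (fun i x Px => (quot_proj0P _ x).2 (ideal_pow_sub Px))
  (fun x => (quot_proj0P _ x).1) (fun i x y => @ideal_pow_mul k L _ i x y)
  tP s s1 sP f0 f0P.
by exists f.
Qed.

(** * Generalized path algebras *)

Section QuotientMaps.
Variables (k : fieldType) (A B : nuAlgType k).

Lemma ideal_preimage (f : {linear A -> B}) (S : set B) :
  {morph f : x y / x ** y} -> is_ideal S -> is_ideal (fun x => S (f x)).
Proof.
move=> fM [sS iS]; split; first split=> [|c u v Su Sv].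
- by rewrite linear0; exact: sS.1.
- by rewrite linearP; exact: sS.2.
- by move=> a x Sx; rewrite !fM; exact: iS.
Qed.

Lemma ideal_zero : is_ideal [set (0 : B)].
Proof.
split; first by split=> // c u v -> ->; rewrite scaler0 addr0.
by move=> a _ ->; rewrite numul0r numulr0.
Qed.

Lemma ideal_pow_morph (f : {linear A -> B}) (I : ideal A) (J : ideal B) t x :
  {morph f : x y / x ** y} -> (forall x, ideal_set I x -> ideal_set J (f x)) ->
  ideal_pow I t x -> ideal_pow J t (f x).
Proof.
move=> fM fI; rewrite /ideal_pow; elim: t.-1 x => [|m IH] x /=; first exact: fI.
set S := span [set z : B | _]; have [sS0 sS] : is_subspace S := @span_subspace _ _ _.
move=> Xx; apply: (Xx (fun x => S (f x))).
  by split=> [|c u v Su Sv]; rewrite ?linear0 // linearP; exact: sS.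
move=> _ [y [z [Xy [Iz ->]]]]; rewrite fM; apply: sub_span.
by exists (f y), (f z); split; [exact: IH | split; [exact: fI|]].
Qed.

Lemma quot_lift (I : ideal A) (f : {linear A -> B}) :
  (forall x, ideal_set I x -> f x = 0) ->
  exists g : {linear quotalg I -> B}, forall x, g (quot_proj I x) = f x.
Proof.
move=> fI; pose g (q : quotalg I) := f (repr q).
have gE x : g (quot_proj I x) = f x.
  by apply/eqP; rewrite -subr_eq0 -linearB fI //; exact: repr_quot_proj.
have g_lin : linear g.
  move=> c; apply: quot_ind => x; apply: quot_ind => y.
  by rewrite -quot_projZ -quot_projD !gE linearP.
pose gL : {linear quotalg I -> B} := HB.pack g (GRing.isLinear.Build _ _ _ _ _ g_lin).
by exists gL.
Qed.

Lemma first_isomorphism (f : {linear A -> B}) : {morph f : x y / x ** y} ->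
  (forall y, exists x, f x = y) ->
  alg_iso B (quotalg (ideal_gen [set x | f x = 0])).
Proof.
move=> fM fsurj; set K := ideal_gen _.
have KE x : ideal_set K x <-> f x = 0.
  split=> [Kx|fx0]; last by move=> S _; apply.
  by apply: (Kx (fun x => f x = 0)) => //; exact: (ideal_preimage fM ideal_zero).
have [g gE] := @quot_lift K f (fun x => (KE x).1).
have gM : {morph g : x y / x ** y}.
  by elim/quot_ind=> x; elim/quot_ind=> y; rewrite -quot_projM !gE.
have [h hK gK] : bijective g.
  apply: bijective_inj_surj => [x y|y].
    elim/quot_ind: x => x; elim/quot_ind: y => y; rewrite !gE => fxy.
    by apply/quot_projP/KE; rewrite linearB /= fxy subrr.
  by have [x <-] := fsurj y; exists (quot_proj K x).
have h_lin : linear h.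
  by move=> c x y; apply: (can_inj hK); rewrite linearP !gK.
pose hL : {linear B -> quotalg K} := HB.pack h (GRing.isLinear.Build _ _ _ _ _ h_lin).
exists hL; split.
  by move=> x y; apply: (can_inj hK); rewrite gM /= !gK.
by exists g.
Qed.

End QuotientMaps.

Section PathAlgebra.
Variables (k : fieldType) (D : digraph) (Omega : vertex D -> nuAlgType k).
Local Notation G := (gpa Omega).

Lemma gpa_ind (S : set G) : is_subspace S ->
  (forall i j (p : opath Omega i j), S (gpa_path p)) -> forall z, S z.
Proof.
move=> [S0 sS] Sp; apply: quot_ind => x.
apply: (path_space_ind (S := fun x => S (quot_proj _ x))) => //.
split=> [|c u v Su Sv]; first by rewrite quot_proj0.
by rewrite quot_projD quot_projZ; exact: sS.
Qed.

Lemma gpa_pathM i j l (p : opath Omega i j) (q : opath Omega j l) :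
  gpa_path p ** gpa_path q = gpa_path (opath_cat p q).
Proof. by rewrite -quot_projM path_vecM. Qed.

Lemma gpa_pathM0 i j j' l (p : opath Omega i j) (q : opath Omega j' l) :
  j' <> j -> gpa_path p ** gpa_path q = 0.
Proof. by move=> ne; rewrite -quot_projM path_vecM0 // quot_proj0. Qed.

Lemma gpa_path_vertex_linear i : linear (fun a : Omega i => gpa_path (OVertex a)).
Proof.
move=> c a b; rewrite /gpa_path -quot_projZ -quot_projD; apply/quot_projP.
have sK := @span_subspace k (path_space Omega) (@multilinear_rel k D Omega).
rewrite (_ : _ - _ = (path_vec (OVertex (c *: a + b))
    - (path_vec (OVertex (c *: a)) + path_vec (OVertex b)))
    + (path_vec (OVertex (c *: a)) - c *: path_vec (OVertex a))); last first.
  by rewrite !opprD !addrA [RHS](ACl (1*5*3*(4*2)))%AC /= subrr addr0.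
apply: (subspaceD sK); apply: sub_span.
  left; exists i, i, (OVertex (c *: a + b)), (OVertex (c *: a)), (OVertex b).
  by split=> //; constructor.
by right; exists i, i, c, (OVertex (c *: a)), (OVertex a); split=> //; constructor.
Qed.

Lemma opath_lmul1 i j (e : Omega i) (p : opath Omega i j) : is_unity e -> opath_lmul e p = p.
Proof. by case: p e => [i' a|x j' a p] e eP /=; rewrite (eP a).1. Qed.

Lemma gpa_path_cons x j (a : Omega (source x)) (p : opath Omega (target x) j)
    (e : Omega (source x)) (f : Omega (target x)) :
  is_unity e -> is_unity f -> gpa_path (OCons a p) =
  gpa_path (OVertex a) ** (gpa_path (OCons e (OVertex f)) ** gpa_path p).
Proof. by move=> eP fP; rewrite !gpa_pathM /= opath_lmul1 // (eP a).2. Qed.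

Lemma gpa_path_vertex0 i : gpa_path (OVertex (0 : Omega i)) = 0.
Proof.
have := gpa_path_vertex_linear (-1) (0 : Omega i) 0.
by rewrite scaler0 addr0 scaleN1r addNr.
Qed.

(** A path a x p is the product of a, of the arrow x and of p. *)
Lemma arrow_ideal_cons x j (a : Omega (source x)) (p : opath Omega (target x) j) :
  (forall i, has_nonzero_unity (Omega i)) ->
  ideal_set (arrow_ideal Omega) (gpa_path (OCons a p)).
Proof.
move=> unity; have [e _ eP] := unity (source x); have [f _ fP] := unity (target x).
rewrite (gpa_path_cons a p eP fP).
have [_ iJ] := ideal_gen_is_ideal (@gpa_arrows k D Omega).
have Jx : ideal_set (arrow_ideal Omega) (gpa_path (OCons e (OVertex f))).
  by move=> S iS; apply; exists x, e, f.
by have [_ Jxp] := iJ (gpa_path p) _ Jx; case: (iJ (gpa_path (OVertex a)) _ Jxp).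
Qed.

Section Evaluation.
Variables (A : nuAlgType k) (s : forall i, Omega i -> A) (X : arrow D -> A).
Hypotheses (s_lin : forall i, linear (@s i))
  (sM : forall i (a b : Omega i), s (a ** b) = s a ** s b)
  (s_orth : forall i j (a : Omega i) (b : Omega j), i <> j -> s a ** s b = 0).

Fixpoint opath_eval i j (p : opath Omega i j) : A :=
  match p with
  | OVertex _ a => s a
  | OCons x _ a p => s a ** (X x ** opath_eval p)
  end.

Lemma opath_eval_lmul i j (a : Omega i) (p : opath Omega i j) :
  opath_eval (opath_lmul a p) = s a ** opath_eval p.
Proof. by case: p a => [i' b|x j' b p] a /=; rewrite sM ?numulA. Qed.

Lemma opath_eval_cat i j l (p : opath Omega i j) (q : opath Omega j l) :
  opath_eval (opath_cat p q) = opath_eval p ** opath_eval q.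
Proof.
elim: p q => [i' a|x j' a p IH] q /=; first exact: opath_eval_lmul.
by rewrite IH !numulA.
Qed.

Lemma opath_eval_cat0 i j j' l (p : opath Omega i j) (q : opath Omega j' l) :
  j <> j' -> opath_eval p ** opath_eval q = 0.
Proof.
elim: p => [i' a|x j1 a p IH] ne /=; last by rewrite -!numulA IH // !numulr0.
by case: q ne => [i1 b|y l1 b q] ne /=; rewrite ?numulA s_orth ?numul0r.
Qed.

Lemma opath_eval_add i j (p p1 p2 : opath Omega i j) :
  opath_add p p1 p2 -> opath_eval p = opath_eval p1 + opath_eval p2.
Proof.
have sD i' (a b : Omega i') : s (a + b) = s a + s b.
  by have := s_lin 1 a b; rewrite !scale1r.
elim=> {i j p p1 p2} [i a b|x j a b p|x j a p p1 p2 _ IH] /=.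
- exact: sD.
- by rewrite sD numulDl.
- by rewrite IH !numulDr.
Qed.

Lemma opath_eval_scale c i j (p p1 : opath Omega i j) :
  opath_scale c p p1 -> opath_eval p = c *: opath_eval p1.
Proof.
have sZ i' (a : Omega i') : s (c *: a) = c *: s a.
  have s0 : s (0 : Omega i') = 0.
    by have := s_lin (-1) (0 : Omega i') 0; rewrite scaler0 addr0 scaleN1r addNr.
  by have := s_lin c a 0; rewrite s0 !addr0.
elim=> {i j p p1} [i a|x j a p|x j a p p1 _ IH] /=.
- exact: sZ.
- by rewrite sZ numulZl.
- by rewrite IH !numulZr.
Qed.

(** The universal property of a generalized path algebra: multiplicative linear
    images of the vertex algebras that annihilate each other, and arbitrary images
    of the arrows, extend to a homomorphism. Non-composable paths have product 0
    because every path starts and ends with an entry in a vertex algebra. *)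
Lemma gpa_eval : exists f : {linear G -> A}, {morph f : x y / x ** y} /\
  forall i j (p : opath Omega i j), f (gpa_path p) = opath_eval p.
Proof.
pose ev : {linear path_space Omega -> A} :=
  free_lift (fun p : gpath Omega => opath_eval (gpath_path p)).
have evP i j (p : opath Omega i j) : ev (path_vec p) = opath_eval p.
  exact: free_liftU.
have [|f fE] := @quot_lift k _ A (Ideal (@multilinear_is_ideal k D Omega)) ev.
  move=> x Kx; apply: (Kx (fun x => ev x = 0)).
    by split=> [|c u v u0 v0]; rewrite ?linear0 // linearP u0 v0 scaler0 addr0.
  move=> _ [[i [j [p [p1 [p2 [h ->]]]]]]|[i [j [c [p [p1 [h ->]]]]]]].
    by rewrite linearB linearD !evP (opath_eval_add h) subrr.
  by rewrite linearB linearZ !evP (opath_eval_scale h) subrr.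
have fp i j (p : opath Omega i j) : f (gpa_path p) = opath_eval p by rewrite fE.
exists f; split=> // x y; move: x y.
apply: (gpa_ind (S := fun x => forall y, f (x ** y) = f x ** f y)).
  split=> [y|c u v fu fv y]; first by rewrite numul0r !linear0 numul0r.
  by rewrite numulDl numulZl !linearP numulDl numulZl fu fv.
move=> i j p; apply: gpa_ind => [|j' l q].
  split=> [|c u v fu fv]; first by rewrite numulr0 !linear0 numulr0.
  by rewrite numulDr numulZr !linearP numulDr numulZr fu fv.
have [e|ne] := EM (j' = j).
  by case: _ / e p => p; rewrite gpa_pathM !fp opath_eval_cat.
by rewrite gpa_pathM0 // linear0 !fp opath_eval_cat0 //; exact/nesym.
Qed.

End Evaluation.
End PathAlgebra.

(** * Presentation by a path algebra *)

Section NumulSums.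
Variables (k : fieldType) (A : nuAlgType k) (I : Type) (r : seq I) (P : pred I) (F : I -> A).

Lemma numul_suml y : (\sum_(i <- r | P i) F i) ** y = \sum_(i <- r | P i) F i ** y.
Proof. exact: (big_morph (fun x => x ** y) (fun a b => numulDl a b y) (numul0r y)). Qed.

Lemma numul_sumr y : y ** (\sum_(i <- r | P i) F i) = \sum_(i <- r | P i) y ** F i.
Proof. exact: (big_morph (fun x => y ** x) (fun a b => numulDr y a b) (numulr0 y)). Qed.

End NumulSums.

Section DirectFactors.
Variables (k : fieldType) (Q : nuAlgType k) (n : nat) (B : 'I_n -> subalgebra Q).
Hypothesis dB : alg_direct_sum B.

Lemma subalg_val_linear (S : subalgebra Q) : linear (@subalg_val k Q S).
Proof. by move=> c x y; exact: (linearP (val : S -> Q)). Qed.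

Lemma subalg_val_inj (S : subalgebra Q) : injective (@subalg_val k Q S).
Proof. exact: (@val_inj _ _ S). Qed.

Lemma subalg_val0 (S : subalgebra Q) : subalg_val (0 : S) = 0.
Proof. by []. Qed.

Lemma factor_mull (b : forall i, B i) i (x : B i) :
  (\sum_j subalg_val (b j)) ** subalg_val x = subalg_val (b i ** x).
Proof.
rewrite numul_suml (bigD1 i) //= big1 ?addr0 // => j /eqP ji.
by have [_ _ h] := dB; exact: h.
Qed.

Lemma factor_mulr (b : forall i, B i) i (x : B i) :
  subalg_val x ** (\sum_j subalg_val (b j)) = subalg_val (x ** b i).
Proof.
rewrite numul_sumr (bigD1 i) //= big1 ?addr0 // => j /eqP ji.
by have [_ _ h] := dB; apply: h; exact/nesym.
Qed.

Lemma factor_unity (u : Q) : is_unity u ->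
  exists2 e : forall i, B i, forall i, is_unity (e i) & u = \sum_i subalg_val (e i).
Proof.
move=> uP; have [h _ _] := dB; have [e eE] := h u; exists e => // i x.
split; apply: (@subalg_val_inj (B i)).
  by rewrite -factor_mull -eE (uP _).1.
by rewrite -factor_mulr -eE (uP _).2.
Qed.

(** A maximal left ideal M of Q restricts to all of B i or to a maximal left
    ideal of B i: if a left ideal N of B i exceeds the restriction, then M + N is
    a left ideal of Q, hence Q; writing the unity of B i as m + y shows that m lies
    in the restriction, hence that the unity lies in N. *)
Lemma jacobson_factor (u : Q) i : is_unity u -> jacobson_set (A := Q) = [set 0] ->
  jacobson_set (A := B i) = [set 0].
Proof.
move=> uP J0; have [e eP eE] := factor_unity uP.
apply/seteqP; split=> [x Jx|_ ->]; last exact: (@jacobson_is_ideal k (B i)).1.1.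
apply: (@subalg_val_inj (B i)); suff : [set 0] (subalg_val x) by [].
rewrite -J0 => M [[sM lM] _ MT Mmax].
pose M' (y : B i) := M (subalg_val y).
have [M'T|M'nT] := EM (M' = setT); first by have : [set: B i] x by []; rewrite -M'T.
have lM' : is_left_ideal M'.
  split=> [|a y]; last exact: lM.
  by split=> [|c v w Mv Mw]; [exact: sM.1 | rewrite /M' subalg_val_linear; exact: sM.2].
suff : modular_maximal_left_ideal M' by exact: Jx.
split=> //.
  by exists (e i) => y; rewrite (eP i y).2 subrr; exact: lM'.1.1.
move=> N [sN lN] M'N; have [NM'|nNM'] := EM (N `<=` M'); first by left; apply/seteqP.
right; have [z Nz M'z] : exists2 z, N z & ~ M' z.
  apply: contrapT => h; apply: nNM' => z Nz; apply: contrapT => M'z; apply: h.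
  by exists z.
pose S (q : Q) := exists m (y : B i), [/\ M m, N y & q = m + subalg_val y].
have lS : is_left_ideal S.
  split; first split.
  - by exists 0, 0; split; [exact: sM.1 | exact: sN.1 | rewrite subalg_val0 addr0].
  - move=> c _ _ [m1 [y1 [Mm1 Ny1 ->]]] [m2 [y2 [Mm2 Ny2 ->]]].
    exists (c *: m1 + m2), (c *: y1 + y2); split; [exact: sM.2 | exact: sN.2 |].
    by rewrite subalg_val_linear scalerDr addrACA.
  - move=> a _ [m [y [Mm Ny ->]]]; have [h _ _] := dB; have [b ->] := h a.
    exists ((\sum_j subalg_val (b j)) ** m), (b i ** y).
    by split; [exact: lM | exact: lN | rewrite numulDr factor_mull].
have [|SM|ST] := Mmax S lS.
- by move=> m Mm; exists m, 0; split=> //; [exact: sN.1 | rewrite subalg_val0 addr0].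
- case: M'z; rewrite /M' -SM; exists 0, z.
  by split; [exact: sM.1 | | rewrite add0r].
have [m [y [Mm Ny ey]]] : S (subalg_val (e i)) by rewrite ST.
have Ne : N (e i).
  rewrite -[e i](subrK y); apply: subspaceD => //; apply: M'N; rewrite /M'.
  by rewrite addrC -scaleN1r subalg_val_linear scaleN1r addrC ey addrK.
by apply/seteqP; split=> // y' _; rewrite -[y'](eP i y').2; apply: lN.
Qed.

End DirectFactors.

Lemma subspace_spanning (k : fieldType) (V : lmodType k) (S : set V) :
  findim V -> is_subspace S -> exists N (b : 'I_N -> V), (forall i, S (b i)) /\
    forall x, S x -> exists c : 'I_N -> k, x = \sum_i c i *: b i.
Proof.
move=> /findim_vectType[W [f [g [fK gK]]]] [S0 sS].
have [|U UE] := @subspace_vspace k W (fun w => S (f w)).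
  by split=> [|c u v Su Sv]; rewrite ?linear0 // linearP; exact: sS.
exists (\dim U), (fun i => f (vbasis U)`_i); split=> [i|x Sx].
  by apply/UE/vbasis_mem/mem_nth; rewrite size_tuple.
have /coord_vbasis gx : g x \in U by apply/UE; rewrite gK.
exists (fun i => coord (vbasis U) i (g x)); rewrite -[LHS]gK [in LHS]gx linear_sum.
by apply: eq_bigr => i _; rewrite linearZ.
Qed.

(** Let sg be a multiplicative section of L -> L / r, let e_i be the unity of B i
    and let the r_l span r. With one arrow from i to j for each (i, j, l), send
    it to sg(e_i) r_l sg(e_j), and B i to L by sg. The image contains sg(L / r) and
    r, so it is L. Arrows go to r, which is nilpotent, so a power of the arrow ideal
    J is in the kernel; and an element of the kernel, written as a vertex part plus
    an element of J, has vertex part 0 because sg(L / r) meets r in 0. *)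
Lemma path_algebra_presentation (k : fieldType) (L : nuAlgType k) (n : nat)
  (B : 'I_n -> subalgebra (quotalg (jacobson L))) :
  perfect_field k -> findim L -> has_nonzero_unity L -> alg_direct_sum B ->
  (forall i, exists x : B i, x <> 0) ->
  exists (E : Type) (s t : E -> 'I_n)
         (D := Digraph s t)
         (Omega := fun i : vertex D => B i : nuAlgType k)
         (rho : set (gpa Omega)),
    [/\ gpa_data Omega, weak_relations rho, finite_digraph D
      & alg_iso L (gpa_rel rho)].
Proof.
move=> perfect_k fL [u u0 uP] dB B0; set Q := quotalg _ in B dB B0 *.
have uQP : is_unity (quot_proj (jacobson L) u) := is_unity_quot uP.
have [e eP eE] := factor_unity dB uQP.
have [sg [sgK sgM sg1]] := wedderburn_principal perfect_k fL u0 uP.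
have [N [r [Jr rP]]] := subspace_spanning fL (jacobson_is_ideal L).1.
pose E := ('I_n * 'I_n * 'I_N)%type.
exists E, (fun x => x.1.1), (fun x => x.1.2) => D Omega.
pose s i (a : Omega i) := sg (subalg_val a).
have s_lin i : linear (@s i).
  by move=> c a b; rewrite /s subalg_val_linear linearP.
have sM i (a b : Omega i) : s i (a ** b) = s i a ** s i b by rewrite /s -sgM.
have s_orth i j (a : Omega i) (b : Omega j) : i <> j -> s i a ** s j b = 0.
  move=> ij; rewrite /s -sgM; have [_ _ h] := dB.
  by rewrite (h i j a b ij) linear0.
have [phi [phiM phiE]] := @gpa_eval k D Omega L s (fun x => r x.2) s_lin sM s_orth.
have phi_v i (a : Omega i) : phi (gpa_path (OVertex a)) = s i a by rewrite phiE.
have su : \sum_i s i (e i) = u by rewrite -[RHS]sg1 eE linear_sum.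
have sum_phi_v (a : forall i, Omega i) :
    phi (\sum_i gpa_path (OVertex (a i))) = sg (\sum_i subalg_val (a i)).
  by rewrite !linear_sum; apply: eq_bigr => i _; exact: phi_v.
pose im x := exists z, phi z = x.
have sim : is_subspace im.
  split; first by exists 0; rewrite linear0.
  by move=> c _ _ [x <-] [y <-]; exists (c *: x + y); rewrite linearP.
have phi_surj y : im y.
  have im_sg q : im (sg q).
    have [h _ _] := dB; have [b ->] := h q.
    by exists (\sum_i gpa_path (@OVertex k D Omega i (b i))).
  have im_r l : im (r l).
    have -> : r l = \sum_i \sum_j s i (e i) ** (r l ** s j (e j)).
      under eq_bigr => i _ do rewrite -numul_sumr -numul_sumr su (uP _).2.
      by rewrite -numul_suml su (uP _).1.
    apply: subspace_sum => // i; apply: subspace_sum => // j.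
    by exists (gpa_path (@OCons k D Omega (i, j, l) j (e i) (OVertex (e j)))); rewrite phiE.
  have im_J x : jacobson_set x -> im x.
    move=> /rP[c ->]; apply: subspace_sum => // l; exact: subspaceZ.
  rewrite -[y](subrK (sg (quot_proj _ y))); apply: subspaceD => //.
  by apply: im_J; apply: (quot_proj0P (jacobson L) _).1; rewrite quot_projB sgK subrr.
have unityB i : has_nonzero_unity (Omega i).
  exists (e i); last exact: eP.
  have [x x0] := B0 i; apply/eqP => ei0; case: x0.
  by rewrite -(eP i x).1 ei0 numul0r.
have phiJ z : ideal_set (arrow_ideal Omega) z -> jacobson_set (phi z).
  move=> Jz; apply: (Jz (fun z => jacobson_set (phi z))).
    exact: ideal_preimage phiM (jacobson_is_ideal L).
  move=> _ [x [e1 [f1 [_ _ ->]]]]; rewrite phiE /=.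
  have iJ := (jacobson_is_ideal L).2.
  by case: (iJ (s _ e1) _ (iJ (s _ f1) _ (Jr x.2)).2).
(* the path algebra is the sum of its vertex part and of J *)
have decompose z : exists a : forall i, Omega i,
    ideal_set (arrow_ideal Omega) (z - \sum_i gpa_path (OVertex (a i))).
  have [sJ iJ] := ideal_gen_is_ideal (@gpa_arrows k D Omega).
  move: z; apply: gpa_ind => [|i j p].
    split.
      exists (fun i => 0); rewrite big1 ?subr0 => [|i _]; first exact: sJ.1.
      exact: gpa_path_vertex0.
    move=> c x y [a Ja] [b Jb]; exists (fun i => c *: a i + b i).
    under eq_bigr => i _ do rewrite gpa_path_vertex_linear.
    rewrite big_split /= -scaler_sumr opprD addrACA -scalerBr.
    exact: sJ.2.
  case: p => [l a|x l a p].
    exists (@dfwith 'I_n Omega (fun=> 0) l a); rewrite (bigD1 l) //= dfwith_in.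
    rewrite big1 => [|l' ll']; first by rewrite addr0 subrr; exact: sJ.1.
    by rewrite dfwith_out 1?eq_sym // gpa_path_vertex0.
  exists (fun i => 0); rewrite big1 => [|i' _]; last exact: gpa_path_vertex0.
  by rewrite subr0; exact: arrow_ideal_cons.
exists [set z | phi z = 0]; split; last exact: first_isomorphism.
- split=> [|i|i].
  + suff [i] : exists i : 'I_n, True by [].
    apply: contrapT => n0; case/eqP: u0; rewrite -su big1 // => i _.
    by case: n0; exists i.
  + exact: unityB.
  + exact: (jacobson_factor dB i uQP (jacobson_quot_jacobson L)).
- split; first by exists 0; rewrite /= linear0.
  have [n' [ax]] := fL; have [t tP] := jacobson_nilpotent ax u0 uP.
  exists t.+1 => //; split=> z.
    by move=> /(ideal_pow_morph (J := jacobson L) phiM phiJ) /tP phiz S _; apply.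
  move=> /(_ _ (ideal_preimage phiM (@ideal_zero k L))) zker.
  have {zker} phiz : phi z = 0 by apply: zker.
  have [a Ja] := decompose z.
  have a0 i : a i = 0.
    have [_ h _] := dB; apply: h; have := phiJ _ Ja.
    rewrite linearB /= phiz sum_phi_v => /(quot_proj0P (jacobson L) _).2.
    by rewrite quot_projB quot_proj0 sgK sub0r => /eqP; rewrite oppr_eq0 => /eqP.
  move: Ja; rewrite big1 ?subr0 // => i _; rewrite a0; exact: gpa_path_vertex0.
- split; exact: finite_finset.
Qed.

(** * Quotients by weak relations *)

Section PathsOfBoundedLength.
Variables (k : fieldType) (D : digraph) (Omega : vertex D -> nuAlgType k).
Local Notation G := (gpa Omega).

Fixpoint opath_length i j (p : opath Omega i j) : nat :=
  match p with OVertex _ _ => 0 | OCons _ _ _ p => (opath_length p).+1 end.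

Lemma arrow_ideal_pow_path t i j (p : opath Omega i j) :
  (forall i, has_nonzero_unity (Omega i)) ->
  (t < opath_length p)%N -> ideal_pow (arrow_ideal Omega) t.+1 (gpa_path p).
Proof.
move=> unity; elim: t i j p => [|t IH] i j [i' a|x j' a p] //= tp.
  exact: arrow_ideal_cons.
have [e _ eP] := unity (source x); have [f _ fP] := unity (target x).
rewrite (gpa_path_cons a p eP fP) numulA.
apply: (@ideal_pow_mul k G (arrow_ideal Omega)); last exact: IH.
by rewrite gpa_pathM; exact: arrow_ideal_cons.
Qed.

Lemma fin_spanned_mul (A : nuAlgType k) (S S' : set A) :
  fin_spanned S -> fin_spanned S' ->
  fin_spanned (fun z => exists x y, [/\ S x, S' y & z = x ** y]).
Proof.
move=> [r rP] [r' r'P]; exists [seq x ** y | x <- r, y <- r'] => _ [x [y [/rP Sx /r'P Sy ->]]].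
set U := span _; have [U0 UL] : is_subspace U := @span_subspace _ _ _.
apply: (Sx (fun x => U (x ** y))) => [|a ra].
  by split=> [|c u v Uu Uv]; rewrite ?numul0r // numulDl numulZl; exact: UL.
apply: (Sy (fun y => U (a ** y))) => [|b rb].
  by split=> [|c u v Uu Uv]; rewrite ?numulr0 // numulDr numulZr; exact: UL.
by apply: sub_span; apply/allpairsP; exists (a, b).
Qed.

Lemma finite_set_enum (T : Type) : finite_set [set: T] ->
  exists n (f : 'I_n -> T), bijective f.
Proof.
case=> n /card_set_bijP[f [fI finj fsurj]].
have f_lt x : (f x < n)%N by exact: fI.
have [g fK gK] : bijective (fun x => Ordinal (f_lt x)).
  apply: bijective_inj_surj => [x y [fxy]|i]; first by apply: finj fxy; rewrite inE.
  by have [x _ fx] := fsurj i (ltn_ord i); exists x; apply: val_inj.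
by exists n, g; exists (fun x => Ordinal (f_lt x)).
Qed.

Lemma fin_spanned_finite_family (V : lmodType k) (T : Type) (S : T -> set V) :
  finite_set [set: T] -> (forall i, fin_spanned (S i)) ->
  fin_spanned (fun x => exists i, S i x).
Proof.
move=> /finite_set_enum[n [f [g _ gK]]] fS.
apply: fin_spanned_sub (fin_spanned_family (fun i => fS (f i))) => x [i Six].
by exists (g i); rewrite gK.
Qed.

Lemma findim_dsum_component i : findim (dsum Omega) -> findim (Omega i).
Proof.
pose f (w : dsum Omega) := w i.
have f_lin : linear f by [].
pose fL : {linear dsum Omega -> Omega i} := HB.pack f (GRing.isLinear.Build _ _ _ _ _ f_lin).
apply: (@findim_surj k _ _ fL) => a.
pose h j : Omega j := if pselect (i = j) is left e then ecast j (Omega j) e a else 0.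
have hfin : finite_set [set j | h j != 0].
  apply: (sub_finite_set _ (finite_set1 i)) => j /=; rewrite /h.
  by case: pselect => [e _|_]; [exact/esym | rewrite eqxx].
exists (Dsum hfin); rewrite /fL /= /f /= /h.
by case: pselect => // e; rewrite (Prop_irrelevance e erefl).
Qed.

(** A path of length t + 1 is a vertex element times an arrow times a path of
    length t, and these three factors range over finitely spanned sets. *)
Lemma fin_spanned_short_paths t : finite_digraph D ->
  (forall i, has_nonzero_unity (Omega i)) -> (forall i, findim (Omega i)) ->
  fin_spanned (fun z : G => exists i j (p : opath Omega i j),
    (opath_length p <= t)%N /\ z = gpa_path p).
Proof.
move=> [finV finA] unity fO.
pose V0 (z : G) := exists i (a : Omega i), z = gpa_path (OVertex a).
pose X0 (z : G) := exists x, z = gpa_path (OCons (sval (cid2 (unity (source x))))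
  (OVertex (sval (cid2 (unity (target x)))))).
have fV0 : fin_spanned V0.
  apply: fin_spanned_finite_family => // i.
  pose f : {linear Omega i -> G} := HB.pack (fun a : Omega i => gpa_path (OVertex a))
    (GRing.isLinear.Build _ _ _ _ _ (@gpa_path_vertex_linear k D Omega i)).
  apply: fin_spanned_sub (fin_spanned_image f (findim_fin_spanned (fO i))).
  by move=> _ [a ->]; exists a.
have fX0 : fin_spanned X0.
  by apply: fin_spanned_finite_family => // x; exact: fin_spanned1.
elim: t => [|t IH].
  apply: fin_spanned_sub fV0 => _ [i [j [[i' a|x j' a p] [//= _ ->]]]].
  by exists i', a.
apply: fin_spanned_sub (fin_spannedU fV0 (fin_spanned_mul fV0 (fin_spanned_mul fX0 IH))).
move=> _ [i [j [[i' a|x j' a p] [/= pt ->]]]]; first by left; exists i', a.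
right; rewrite (gpa_path_cons a p (svalP (cid2 (unity (source x)))).2
                              (svalP (cid2 (unity (target x)))).2).
do 2!eexists; split; [by exists (source x), a | | reflexivity].
by do 2!eexists; split; [by exists x | by exists (target x), j', p | reflexivity].
Qed.

End PathsOfBoundedLength.

Section WeakRelations.
Variables (k : fieldType) (D : digraph) (Omega : vertex D -> nuAlgType k).
Variable rho : set (gpa Omega).
Local Notation G := (gpa Omega).
Hypotheses (dO : gpa_data Omega) (wrho : weak_relations rho) (fD : finite_digraph D).

(** A path of length at least t lies in J^t, so the quotient is spanned by the
    images of the paths of length at most t. *)
Lemma findim_gpa_rel : findim (dsum Omega) -> findim (gpa_rel rho).
Proof.
move=> fO; have [_ unity _] := dO; have [_ [[//|t] _ [Jt _]]] := wrho.
have := fin_spanned_short_paths t fD unity (fun i => findim_dsum_component i fO).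
move=> /(fin_spanned_image (quot_proj_linear (ideal_gen rho))) /fin_spanned_span fS.
apply: fin_spanned_findim; apply: fin_spanned_sub fS => + _.
set S := span _; have sS : is_subspace S := @span_subspace _ _ _.
apply: quot_ind; apply: (gpa_ind (S := fun z => S (quot_proj _ z))).
  split=> [|c u v Su Sv]; first by rewrite quot_proj0; exact: sS.1.
  by rewrite quot_projD quot_projZ; exact: sS.2.
move=> i j p; have [pt|tp] := leqP (opath_length p) t.
  by apply: sub_span; exists (gpa_path p) => //; exists i, j, p.
rewrite (_ : quot_proj _ _ = 0); first exact: sS.1.
apply/quot_proj0P; have := arrow_ideal_pow_path unity tp; exact: Jt.
Qed.

Lemma opath_cat1 i j (p : opath Omega i j) (e : Omega j) :
  is_unity e -> opath_cat p (OVertex e) = p.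
Proof.
elim: p e => [i' a|x j' a p IH] e eP /=; first by rewrite (eP a).2.
by rewrite IH.
Qed.

(** The projection of the path algebra onto one of the algebras at the vertices,
    which kills the arrows, shows that the unity is not in J. *)
Lemma gpa_rel_unity : has_nonzero_unity (gpa_rel rho).
Proof.
have [[i0] unity _] := dO; have [n [v [v' v'K vK]]] := finite_set_enum fD.1.
pose e i : Omega i := sval (cid2 (unity i)).
have e0 i : e i != 0 := (svalP (cid2 (unity i))).1.
have eP i : is_unity (e i) := (svalP (cid2 (unity i))).2.
pose one : G := \sum_l gpa_path (OVertex (e (v l))).
have oneP : is_unity one.
  apply: gpa_ind => [|i j p].
    split=> [|c x y [x1 x2] [y1 y2]]; first by rewrite numul0r numulr0.
    by rewrite numulDr numulDl numulZl numulZr x1 x2 y1 y2.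
  have one_mull l (q : opath Omega (v l) j) : one ** gpa_path q = gpa_path q.
    rewrite /one numul_suml (bigD1 l) //= big1 ?addr0 => [|l' l'l].
      by rewrite gpa_pathM /= opath_lmul1.
    by apply: gpa_pathM0 => /(can_inj v'K) ll'; rewrite ll' eqxx in l'l.
  have one_mulr l (q : opath Omega i (v l)) : gpa_path q ** one = gpa_path q.
    rewrite /one numul_sumr (bigD1 l) //= big1 ?addr0 => [|l' l'l].
      by rewrite gpa_pathM opath_cat1.
    by apply: gpa_pathM0 => /(can_inj v'K) ll'; rewrite ll' eqxx in l'l.
  split.
    by move: p; case: _ / (vK i) => p; exact: one_mull.
  by move: p; case: _ / (vK j) => p; exact: one_mulr.
pose s i (a : Omega i) : Omega i0 :=
  if pselect (i = i0) is left h then ecast i (Omega i) h a else 0.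
have s_lin i : linear (@s i).
  move=> c a b; rewrite /s; case: pselect => [h|_]; last by rewrite scaler0 addr0.
  by case: _ / h.
have sM i (a b : Omega i) : s i (a ** b) = s i a ** s i b.
  rewrite /s; case: pselect => [h|_]; last by rewrite numul0r.
  by case: _ / h.
have s_orth i j (a : Omega i) (b : Omega j) : i <> j -> s i a ** s j b = 0.
  rewrite /s; case: pselect => [h|_]; case: pselect => [h'|_] ij; rewrite ?numul0r ?numulr0 //.
  by case: ij; rewrite h h'.
have [phi [phiM phiE]] := @gpa_eval k D Omega (Omega i0) s (fun=> 0) s_lin sM s_orth.
have phi_one : phi one = e i0.
  rewrite linear_sum (bigD1 (v' i0)) //= big1 ?addr0 => [|l lv].
    rewrite phiE /= /s; case: pselect => [h|]; last by rewrite vK.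
    by move: (v (v' i0)) h => i1 h; case: _ / h.
  rewrite phiE /= /s; case: pselect => // h.
  by case/eqP: lv; rewrite -h v'K.
exists (quot_proj _ one); last exact: is_unity_quot.
have [_ [_ _ [_ rhoJ]]] := wrho; apply/eqP => /quot_proj0P /rhoJ Jone.
have : [set 0] (phi one).
  apply: (Jone _ (ideal_preimage phiM (@ideal_zero k (Omega i0)))).
  by move=> _ [x [a [b [_ _ ->]]]]; rewrite /= phiE /= numul0r numulr0.
by rewrite /= phi_one => /eqP; apply/negP.
Qed.

End WeakRelations.

(** * Coarser decompositions *)

Section Grouping.
Variables (k : fieldType) (Q : nuAlgType k) (n m : nat) (B : 'I_n -> subalgebra Q).
Variable g : 'I_n -> 'I_m.
Hypothesis dB : alg_direct_sum B.

Let sum_fiber (i : 'I_m) (b : forall j, B j) : Q := \sum_(j | g j == i) subalg_val (b j).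
Let fiber_set i : set Q := fun q => exists b, q = sum_fiber i b.

Lemma fiber_subspace i : is_subspace (fiber_set i).
Proof.
split; first by exists (fun=> 0); rewrite /sum_fiber big1.
move=> c _ _ [a ->] [b ->]; exists (fun j => c *: a j + b j).
rewrite /sum_fiber scaler_sumr -big_split; apply: eq_bigr => j _.
exact: subalg_val_linear.
Qed.

Lemma fiber_mul i x y : fiber_set i x -> fiber_set i y -> fiber_set i (x ** y).
Proof.
move=> [a ->] [b ->]; exists (fun j => a j ** b j).
rewrite /sum_fiber numul_suml; apply: eq_bigr => j gj.
rewrite numul_sumr (bigD1 j) //= big1 ?addr0 // => j' /andP[_ /eqP jj'].
by have [_ _ h] := dB; apply: h; exact/nesym.
Qed.

Definition fiber_sum i : subalgebra Q := Subalgebra (fiber_subspace i) (@fiber_mul i).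

Lemma fiber_sumP i (x : fiber_sum i) : exists b, subalg_val x = sum_fiber i b.
Proof. exact/asboolP/(subalg_valP x). Qed.

Lemma alg_direct_sum_fibers : alg_direct_sum fiber_sum.
Proof.
have [Bsum Buniq Borth] := dB; split.
- move=> x; have [b ->] := Bsum x.
  have mem i : sum_fiber i b \in subalg_mem (fiber_sum i) by apply/asboolP; exists b.
  exists (fun i => SubalgElt (mem i)).
  by rewrite (partition_big g xpredT).
- move=> b b0 i; pose c i := sval (cid (fiber_sumP (b i))).
  have cE i' : subalg_val (b i') = sum_fiber i' (c i') by rewrite /c; case: cid.
  have d0 : forall j, c (g j) j = 0.
    apply: (Buniq (fun j => c (g j) j)); rewrite -[RHS]b0.
    rewrite (partition_big g xpredT) //=; apply: eq_bigr => i' _.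
    by rewrite cE; apply: eq_bigr => j /eqP ->.
  apply: (@subalg_val_inj _ _ (fiber_sum i)); rewrite cE /sum_fiber big1 // => j /eqP <-.
  by rewrite d0.
- move=> i j x y ij; have [a ->] := fiber_sumP x; have [b ->] := fiber_sumP y.
  rewrite /sum_fiber numul_suml big1 // => i' /eqP gi; rewrite numul_sumr big1 // => j' /eqP gj.
  by apply: Borth => ij'; apply: ij; rewrite -gi -gj ij'.
Qed.

Lemma fiber_sum_neq0 j : (exists x : B j, x <> 0) -> exists x : fiber_sum (g j), x <> 0.
Proof.
move=> [x x0]; pose b := @dfwith 'I_n (fun j => B j : Type) (fun=> 0) j x.
have bE : sum_fiber (g j) b = subalg_val x.
  rewrite /sum_fiber (bigD1 j) //= /b dfwith_in big1 ?addr0 // => l /andP[_ lj].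
  by rewrite dfwith_out // eq_sym.
have mem : subalg_val x \in subalg_mem (fiber_sum (g j)) by apply/asboolP; exists b.
exists (SubalgElt mem) => /(congr1 (@subalg_val _ _ _)) /= xe; apply: x0.
exact: (@subalg_val_inj _ _ (B j)).
Qed.

End Grouping.

Section WholeAlgebra.
Variables (k : fieldType) (Q : nuAlgType k).

Definition whole : subalgebra Q.
Proof. by apply: (@Subalgebra k Q setT). Defined.

Lemma alg_direct_sum_whole : alg_direct_sum (fun _ : 'I_1 => whole).
Proof.
split=> [x|b|i j x y].
- have mem : x \in subalg_mem whole by apply/asboolP.
  by exists (fun=> SubalgElt mem); rewrite big_ord1.
- by rewrite big_ord1 => b0 i; rewrite (ord1 i); exact: (@subalg_val_inj _ _ whole).
- by rewrite (ord1 i) (ord1 j).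
Qed.

End WholeAlgebra.

Lemma simple_neq0 (k : fieldType) (A : nuAlgType k) : simple_alg A -> exists x : A, x <> 0.
Proof.
by move=> [[x [y xy]] _]; exists x => x0; move: xy; rewrite x0 numul0r eqxx.
Qed.

Lemma alg_iso_unital (k : fieldType) (A B : nuAlgType k) : alg_iso A B ->
  findim B -> has_nonzero_unity B -> findim A /\ has_nonzero_unity A.
Proof.
move=> [f [fM [g fK gK]]] fB [u u0 uP]; split.
  exact: findim_inj (can_inj fK) fB.
exists (g u); first by apply: contra_neq u0 => gu; rewrite -[u]gK gu linear0.
by move=> x; split; apply: (can_inj fK); rewrite fM gK; case: (uP (f x)).
Qed.

Lemma findim_dsum1 (k : fieldType) (Q : nuAlgType k) (B : 'I_1 -> subalgebra Q) :
  findim Q -> findim (dsum (fun i => B i : nuAlgType k)).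
Proof.
pose f (w : dsum (fun i => B i : nuAlgType k)) : Q := subalg_val (w ord0).
have f_lin : linear f by move=> c v w; exact: subalg_val_linear.
pose fL : {linear _ -> Q} := HB.pack f (GRing.isLinear.Build _ _ _ _ _ f_lin).
apply: (@findim_inj k _ _ fL) => v w /subalg_val_inj vw.
by apply: dsumP => i; rewrite (ord1 i).
Qed.

Theorem corollary3p13 (k : fieldType) (perfect_k : perfect_field k) :
  (forall L : nuAlgType k,
     (findim L /\ has_nonzero_unity L) <->
     (exists (D : digraph) (Omega : vertex D -> nuAlgType k)
             (rho : set (gpa Omega)),
        [/\ gpa_data Omega, weak_relations rho, finite_digraph D,
            findim (dsum Omega) & alg_iso L (gpa_rel rho)]))
  /\
  (forall L : nuAlgType k, findim L -> has_nonzero_unity L ->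
     forall (n : nat) (B : 'I_n -> subalgebra (quotalg (jacobson L))),
       simple_decomposition B ->
       exists (E : Type) (s t : E -> 'I_n)
              (D := Digraph s t)
              (Omega := fun i : vertex D => B i : nuAlgType k)
              (rho : set (gpa Omega)),
         [/\ gpa_data Omega, weak_relations rho, finite_digraph D
           & alg_iso L (gpa_rel rho)])
  /\
  (forall L : nuAlgType k, findim L -> has_nonzero_unity L ->
     forall m : nat, (1 <= m <= n_WA L)%N ->
       exists (D : digraph) (Omega : vertex D -> nuAlgType k)
              (rho : set (gpa Omega)),
         [/\ gpa_data Omega, weak_relations rho,
             ([set: vertex D] #= `I_m)%card & alg_iso L (gpa_rel rho)]).
Proof.
split; [|split].
- move=> L; split; last first.
    move=> [D [Omega [rho [dO wrho fD fO iso]]]]; apply: alg_iso_unital iso _ _.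
      exact: findim_gpa_rel.
    exact: gpa_rel_unity.
  (* one vertex, carrying L / r *)
  move=> [fL uL]; have [u u0 uP] := uL.
  have uQ : exists x : whole (quotalg (jacobson L)), x <> 0.
    have mem : quot_proj (jacobson L) u \in subalg_mem (whole _) by apply/asboolP.
    exists (SubalgElt mem) => /(congr1 (@subalg_val _ _ _)) /= /quot_proj0P.
    exact: jacobson_neq_unity fL u0 uP.
  have [E [s [t [rho [dO wrho fD iso]]]]] := path_algebra_presentation perfect_k fL uL
    (alg_direct_sum_whole (quotalg (jacobson L))) (fun=> uQ).
  exists (Digraph s t); exists (fun i : 'I_1 => whole (quotalg (jacobson L)) : nuAlgType k).
  exists rho; split=> //.
  exact: findim_dsum1 (fun=> whole _) (findim_quotalg _ fL).
- move=> L fL uL n B [dB sB].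
  exact: path_algebra_presentation perfect_k fL uL dB (fun i => simple_neq0 (sB i)).
(* n_WA takes its default value 0 only if there is no decomposition *)
move=> L fL uL m /andP[m1]; rewrite /n_WA; case: xgetP => [n _ [B [dB sB]] mn|_ m0]; last first.
  by rewrite leqNgt m1 in m0.
case: m m1 mn => // m _ mn.
(* the last vertex collects all the simple factors from the m-th on, counted from 0 *)
pose g (j : 'I_n) : 'I_m.+1 := inord (minn j m).
have gB i : exists x : fiber_sum g dB i, x <> 0.
  have im : (i < n)%N := leq_trans (ltn_ord i) mn.
  have -> : i = g (Ordinal im).
    by apply: val_inj; rewrite /g /= (minn_idPl _) ?inordK // -ltnS.
  exact: fiber_sum_neq0 (simple_neq0 (sB _)).
have [E [s [t [rho [dO wrho fD iso]]]]] := path_algebra_presentation perfect_k fL uL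
  (alg_direct_sum_fibers g dB) gB.
exists (Digraph s t); exists (fun i : 'I_m.+1 => fiber_sum g dB i : nuAlgType k).
by exists rho; split=> //; rewrite card_eq_sym; exact: card_II.
Qed.
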